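(* Let $K\subset\mathbb{R}^n$ be a convex body with nonempty interior. Suppose that $$\mathcal{U}\bigl((K_\lambda)^*\bigr)=\mathcal{U}\bigl(K_\lambda+(K_\lambda)^*\bigr)\quad\text{for all } -\mathrm{r}(K;B_n)<\lambda\le 0 .$$ Then the isoperimetric quotient $$\lambda\longmapsto\frac{\mathrm{S}(K_\lambda)^n}{\mathrm{vol}(K_\lambda)^{n-1}}$$ is a non-increasing function of $\lambda$ on $-\mathrm{r}(K;B_n)<\lambda\le 0$.
   Context: A convex body in $\mathbb{R}^n$ is a nonempty compact convex set. $B_n$ is the closed Euclidean unit ball of $\mathbb{R}^n$ and $\mathbb{S}^{n-1}$ the unit sphere. $\mathrm{vol}$ denotes $n$-dimensional Lebesgue measure and $\mathrm{S}$ the surface area (measure of the boundary; for a convex body $L$ with nonempty interior, $\mathrm{S}(L)=\lim_{\varepsilon\to0^+}(\mathrm{vol}(L+\varepsilon B_n)-\mathrm{vol}(L))/\varepsilon$). Sums of sets are Minkowski sums. Inradius: $\mathrm{r}(K;B_n)=\sup\{r\ge 0:\exists\,x\in\mathbb{R}^n \text{ with } x+rB_n\subseteq K\}$. Inner parallel bodies: for $-\mathrm{r}(K;B_n)\le\lambda\le 0$, $K_\lambda=\{x\in\mathbb{R}^n: x+|\lambda|B_n\subseteq K\}$. For $\lambda>-\mathrm{r}(K;B_n)$ it has nonempty interior. Extreme normal vectors: for a convex body $L$, a vector $u\in\mathbb{S}^{n-1}$ is a ($0$-)extreme normal vector of $L$ if it cannot be written as a linear combination with positive coefficients of two linearly independent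 (outer) normal vectors of $L$ at one and the same boundary point of $L$. $\mathcal{U}(L)$ denotes the set of all extreme normal vectors of $L$. Form body (with respect to $B_n$): for a convex body $L$ with nonempty interior, $L^*=\{x\in\mathbb{R}^n:\langle x,u\rangle\le 1 \text{ for all } u\in\mathcal{U}(L)\}$. *)

(* Defs.v *)
From mathcomp Require Import all_boot all_order all_algebra.
From mathcomp Require Import all_classical all_reals all_analysis.
Import Order.TTheory GRing.Theory Num.Theory.
Import numFieldNormedType.Exports.

Set Implicit Arguments.
Unset Strict Implicit.
Unset Printing Implicit Defensive.

Local Open Scope classical_set_scope.
Local Open Scope ring_scope.

Section Euclidean.
Context {R : realType} {n : nat}.
Implicit Types (x y u v : 'rV[R]_n) (A B L : set 'rV[R]_n).

Definition dotp x y : R := \sum_(i < n) x 0 i * y 0 i.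

(* The library norm on ['rV[R]_n] is the sup norm (it induces the same
   topology), hence the separate Euclidean norm. *)
Definition enorm x : R := Num.sqrt (dotp x x).

Definition unit_ball : set 'rV[R]_n := [set x | enorm x <= 1].

Definition unit_sphere : set 'rV[R]_n := [set u | enorm u = 1].

Definition minkowski_sum A B : set 'rV[R]_n := [set x + y | x in A & y in B].

Definition dilate (r : R) A : set 'rV[R]_n := [set r *: x | x in A].

Definition translate x A : set 'rV[R]_n := [set x + y | y in A].

Definition boundary A : set 'rV[R]_n := closure A `\` interior A.

Definition convex_body A : Prop :=
  [/\ A !=set0, compact A & convex_set (A : set (convex_lmodType 'rV[R]_n))].

End Euclidean.

(* n-dimensional Lebesgue measure, as the iterated product of the Lebesgue
   measure on the line. *)
Fixpoint lebesgue_tuple (R : realType) (n : nat) :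
    set (n.-tuple (measurableTypeR R)) -> \bar R :=
  match n with
  | 0 => \d_[tuple]
  | m.+1 => pushforward (lebesgue_measure \x lebesgue_tuple (n := m))%E
      (fun p : measurableTypeR R * m.-tuple (measurableTypeR R) =>
         [tuple of p.1 :: p.2])
  end.

Section ConvexBodies.
Context {R : realType} {n : nat}.
Implicit Types (x y u v : 'rV[R]_n) (K L : set 'rV[R]_n).

(* [fine] is harmless here: bounded sets have finite measure. *)
Definition vol L : R :=
  fine (lebesgue_tuple [set t : n.-tuple R | L (\row_i tnth t i)]).

Definition surface_area L : R :=
  lim ((vol (minkowski_sum L (dilate e unit_ball)) - vol L) / e @[e --> 0^'+]).

Definition inradius K : R :=
  sup [set r : R | 0 <= r /\ exists x, translate x (dilate r unit_ball) `<=` K].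

Definition inner_parallel K (l : R) : set 'rV[R]_n :=
  [set x | translate x (dilate `|l| unit_ball) `<=` K].

Definition outer_normal L x u : Prop :=
  u != 0 /\ forall y, L y -> dotp y u <= dotp x u.

Definition extreme_normals L : set 'rV[R]_n :=
  [set u | unit_sphere u /\
     ~ exists x v w (a b : R),
         [/\ (L `&` boundary L) x, outer_normal L x v /\ outer_normal L x w,
             free [:: v; w], 0 < a /\ 0 < b & u = a *: v + b *: w]].

Definition form_body L : set 'rV[R]_n :=
  [set x | forall u, extreme_normals L u -> dotp x u <= 1].

Definition isoperimetric_quotient L : R :=
  surface_area L ^+ n / vol L ^+ n.-1.

End ConvexBodies.

(* Main.v *)
(* For a convex body A let f(A) = vol(A)^(1/n).  By the Brunn-Minkowski
   inequality f is concave along the outer parallel bodies A + e B_n, hence its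
   right derivative D(A) at e = 0 exists, S(A) = n f(A)^(n-1) D(A), and the
   isoperimetric quotient of A equals (n D(A))^n.  It remains to see that
   D(K_m) <= D(K_l) for l < m.  The family consisting of the inner parallel
   bodies K_t, t <= m, and the outer parallel bodies K_m + e B_n is concave as
   well, so D(K_m) is at most every difference quotient of t |-> f(K_t) to the
   left of l.  These quotients are compared with D(K_l) by the inequality
   2 vol(L) <= vol(L_(-d)) + vol(L + d B_n) (up to o(d)): for a polytope L the
   part of the inner shell of width d nearest to a given facet can be translated
   outwards by d along the normal of that facet, and the translates stay disjoint. *)
From HB Require Import structures.
Require Import Defs.
From mathcomp Require Import all_boot all_order all_algebra.
From mathcomp Require Import all_classical all_reals all_analysis.
From mathcomp Require Import measurable_realfun ring lra.
Import Order.TTheory GRing.Theory Num.Theory.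
Import numFieldNormedType.Exports.

Set Implicit Arguments.
Unset Strict Implicit.
Unset Printing Implicit Defensive.

Local Open Scope classical_set_scope.
Local Open Scope ring_scope.

(** * Lebesgue measure on tuples *)

(** The shell inequality is exact only for polytopes, and passing from L to a circumscribed polytope
    costs a Hausdorff error. That error is taken proportional to the step, [k = (1 - c) * d] with a
    fixed [c < 1], so it appears as the asymmetric radii [c * d] and [(2 - c) * d] instead of a
    remainder to be estimated. If a slope s of K_m exceeded D(L) for L = K_l, concavity would give
    f(L_(-cd)) <= f(L) - s c d, while f(L + (2 - c) d B_n) <= f(L) + D(L) (2 - c) d. Inserted in the
    shell inequality, with d tending to 0, this leaves s c <= (2 - c) D(L), which fails for c close
    to 1. Brunn-Minkowski itself is derived from the Prekopa-Leindler inequality on the line by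
    induction on the dimension. It is stated throughout for a set C that contains the combinations
    of A and B, since a Minkowski sum of measurable sets need not be measurable. *)

Lemma preimage_measurable {d d'} {T : measurableType d} {T' : measurableType d'}
    (f : T -> T') (A : set T') :
  measurable_fun setT f -> measurable A -> measurable (f @^-1` A).
Proof. by move=> mf mA; rewrite -[X in measurable X]setTI; exact: mf. Qed.

(** A pushforward need not stay sigma-finite; here the measurable left inverse [g] carries an
    exhaustion [F] across, because the preimage under [f] of the preimage under [g] of [F k] is
    [F k] again. The conclusion equates set functions so that it can rewrite the recursion
    [lebesgue_tuple]. *)
Lemma sigma_finite_pushforward {R : realType} {d d'} {T : measurableType d}
    {T' : measurableType d'} (m : {measure set T -> \bar R})
    (f : T -> T') (g : T' -> T) :
  sigma_finite setT m ->
  measurable_fun setT f -> measurable_fun setT g -> cancel f g ->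
  exists mu : {sigma_finite_measure set T' -> \bar R},
    pushforward m f = mu :> (set T' -> \bar R).
Proof.
move=> [F FT Foo] mf mg fK.
pose nu : set T' -> \bar R := pushforward m f.
have nu0 : nu set0 = 0%E by rewrite /nu /pushforward preimage_set0 measure0.
have nu_ge0 A : (0 <= nu A)%E by exact: measure_ge0.
have nu_sadd : semi_sigma_additive nu.
  move=> G mG tG mUG; rewrite /nu /pushforward preimage_bigcup.
  apply: measure_semi_sigma_additive.
  - by move=> k; exact: preimage_measurable.
  - apply/trivIsetP => /= i j _ _ ij; rewrite -preimage_setI.
    by move/trivIsetP : tG => /(_ _ _ _ _ ij) ->//; rewrite preimage_set0.
  - by rewrite -preimage_bigcup; exact: preimage_measurable.
have nu_sf : sigma_finite setT nu.
  exists (fun k => g @^-1` F k).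
    by rewrite -preimage_bigcup -FT preimage_setT.
  move=> k; have [mF Fk] := Foo k; split; first exact: preimage_measurable.
  rewrite /nu /pushforward -comp_preimage.
  by rewrite (_ : _ \o _ = id) ?preimage_id//; apply/funext/fK.
pose m1 := isMeasure.Build _ _ _ nu nu0 nu_ge0 nu_sadd.
pose nu' : measure _ _ := HB.pack nu m1.
pose m2 := Measure_isSigmaFinite.Build _ _ _ nu' nu_sf.
pose nu'' : sigma_finite_measure _ _ := HB.pack nu nu' m2.
by exists nu''.
Qed.

(* In the library the subprobability instance of [\x] hides the sigma-finite one. *)
Lemma sigma_finite_product {R : realType} {d1 d2} {T1 : measurableType d1}
    {T2 : measurableType d2} (m1 : {sigma_finite_measure set T1 -> \bar R})
    (m2 : {sigma_finite_measure set T2 -> \bar R}) :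
  sigma_finite setT (m1 \x m2)%E.
Proof.
have /sigma_finiteP[F [TF ndF Foo]] := sigma_finiteT m1.
have /sigma_finiteP[G [TG ndG Goo]] := sigma_finiteT m2.
exists (fun n => F n `*` G n) => [|k]; last first.
  have [? ?] := Foo k; have [? ?] := Goo k; split; first exact: measurableX.
  by rewrite product_measure1E// lte_mul_pinfty// ge0_fin_numE.
rewrite -setXTT TF TG predeqE => -[x y]; split=> [|[n _ []]]; last by split; exists n.
move=> [/= [n _ Fnx] [k _ Gky]]; exists (maxn n k) => //; split.
- by move: x Fnx; exact/subsetPset/ndF/leq_maxl.
- by move: y Gky; exact/subsetPset/ndG/leq_maxr.
Qed.

Lemma product_pushforward {R : realType} {d1 d2 d'} {T1 : measurableType d1}
    {T2 : measurableType d2} {T' : measurableType d'}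
    (m1 : {sigma_finite_measure set T1 -> \bar R})
    (m2 : {sigma_finite_measure set T2 -> \bar R})
    (f : T1 * T2 -> T') (g : T' -> T1 * T2) :
  measurable_fun setT f -> measurable_fun setT g -> cancel f g ->
  exists mu : {sigma_finite_measure set T' -> \bar R},
    pushforward (m1 \x m2)%E f = mu :> (set T' -> \bar R).
Proof. by apply: sigma_finite_pushforward; exact: sigma_finite_product. Qed.

Section lebesgue_tuple_measure.
Context {R : realType}.
Notation RT := (measurableTypeR R).

Definition tuple_cons {n} (p : RT * n.-tuple RT) : n.+1.-tuple RT :=
  [tuple of p.1 :: p.2].

Definition tuple_uncons {n} (t : n.+1.-tuple RT) : RT * n.-tuple RT :=
  (thead t, [tuple of behead t]).

Lemma tuple_consK n : cancel tuple_cons (@tuple_uncons n).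
Proof.
by move=> [x t]; rewrite /tuple_uncons /= theadE; congr pair; exact/val_inj.
Qed.

Lemma measurable_tuple_cons n : measurable_fun setT (@tuple_cons n).
Proof. by apply: measurable_cons. Qed.

Lemma measurable_tuple_uncons n : measurable_fun setT (@tuple_uncons n).
Proof.
apply: measurable_fun_pair; last exact: measurable_behead.
exact: (measurable_tnth (T := RT) ord0).
Qed.


(** [lebesgue_tuple] is a bare recursive set function, so the induction has to replace its tail by a
    packaged measure before the product construction applies. The instances declared next are read
    off from this equality. *)
Lemma lebesgue_tuple_sigma_finite_measure n :
  exists mu : {sigma_finite_measure set (n.-tuple RT) -> \bar R},
    lebesgue_tuple (n := n) = mu :> (set (n.-tuple RT) -> \bar R).
Proof.
elim: n => [|n [mu muE]].
  exists (\d_([tuple] : 0.-tuple RT) : {sigma_finite_measure set (0.-tuple RT) -> \bar R}).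
  by [].
rewrite /= muE.
exact: (product_pushforward _ _ (@measurable_tuple_cons n)
  (@measurable_tuple_uncons n) (@tuple_consK n)).
Qed.
End lebesgue_tuple_measure.

Section lebesgue_tuple_instances.
Context {R : realType} (n : nat).
Notation RT := (measurableTypeR R).

Let lebesgue_tuple0 : lebesgue_tuple (set0 : set (n.-tuple RT)) = 0%E.
Proof.
by have [mu ->] := @lebesgue_tuple_sigma_finite_measure R n; exact: measure0.
Qed.

Let lebesgue_tuple_ge0 (A : set (n.-tuple RT)) : (0 <= lebesgue_tuple A)%E.
Proof.
by have [mu ->] := @lebesgue_tuple_sigma_finite_measure R n; exact: measure_ge0.
Qed.

Let lebesgue_tuple_sadd : semi_sigma_additive (@lebesgue_tuple R n).
Proof.
have [mu ->] := @lebesgue_tuple_sigma_finite_measure R n.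
exact: measure_semi_sigma_additive.
Qed.

HB.instance Definition _ := isMeasure.Build _ _ _ (@lebesgue_tuple R n)
  lebesgue_tuple0 lebesgue_tuple_ge0 lebesgue_tuple_sadd.

Let lebesgue_tuple_sf : sigma_finite setT (@lebesgue_tuple R n).
Proof.
have [mu ->] := @lebesgue_tuple_sigma_finite_measure R n.
exact: sigma_finiteT.
Qed.

HB.instance Definition _ :=
  Measure_isSigmaFinite.Build _ _ _ (@lebesgue_tuple R n) lebesgue_tuple_sf.

End lebesgue_tuple_instances.

(** * Slices and affine images *)

Section sections.
Context {R : realType}.
Notation RT := (measurableTypeR R).
Local Open Scope ereal_scope.

Definition tsection n (A : set (n.+1.-tuple RT)) (x : RT) : set (n.-tuple RT) :=
  [set t | A (tuple_cons (x, t))].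

Lemma lebesgue_tupleS n (A : set (n.+1.-tuple RT)) :
  lebesgue_tuple A = \int[lebesgue_measure]_x lebesgue_tuple (tsection A x).
Proof.
rewrite /= /pushforward /product_measure1; apply: eq_integral => x _ /=.
by congr lebesgue_tuple; apply/seteqP; split => t; rewrite /xsection/= inE.
Qed.

Lemma tsectionE n (A : set (n.+1.-tuple RT)) (x : RT) :
  tsection A x = xsection (@tuple_cons R n @^-1` A) x.
Proof. by apply/seteqP; split => t; rewrite /xsection/= inE. Qed.

Lemma measurable_tsection n (A : set (n.+1.-tuple RT)) (x : RT) :
  measurable A -> measurable (tsection A x).
Proof.
move=> mA; rewrite tsectionE; apply: measurable_xsection.
exact: preimage_measurable (@measurable_tuple_cons R n) mA.
Qed.

Lemma measurable_fun_tsection n (A : set (n.+1.-tuple RT)) :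
  measurable A -> measurable_fun setT ((fun x => lebesgue_tuple (tsection A x)) : RT -> \bar R).
Proof.
move=> mA; rewrite (_ : (fun x => _) = lebesgue_tuple (n := n) \o
    xsection (@tuple_cons R n @^-1` A)).
  apply: measurable_fun_xsection.
  exact: preimage_measurable (@measurable_tuple_cons R n) mA.
by apply/funext => x; rewrite tsectionE.
Qed.

(** Uniqueness of Lebesgue measure: [r] times the pushforward under [x |-> a + r x] agrees with it
    on half-open intervals. Affine images are written as preimages here and below, so that
    measurability comes from the map. *)
Lemma lebesgue_measure_affine (a r : R) (A : set RT) : (0 < r)%R -> measurable A ->
  lebesgue_measure ((fun x : RT => (a + r * x)%R : RT) @^-1` A)
    = r^-1%:E * lebesgue_measure A.
Proof.
move=> r0 mA.
pose f := (fun x : RT => (a + r * x)%R : RT).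
have mf : measurable_fun setT f.
  by apply: measurable_funD => //; exact: measurable_funM.
pose r' := NngNum (ltW r0).
suff -> : lebesgue_measure A = r%:E * lebesgue_measure (f @^-1` A).
  by rewrite muleA -EFinM mulVf ?gt_eqF// mul1e.
apply: (@lebesgue_measure_unique _ (mscale r' (pushforward (@lebesgue_measure R) f))) => //.
move=> _ [[c d] _ <-];
have E : f @^-1` `]c, d]%classic = `](c - a) / r, (d - a) / r]%classic%R.
  apply/seteqP; split=> x; rewrite /f /= !in_itv/= ltr_pdivrMr// ler_pdivlMr//;
  by rewrite ltrBlDl lerBrDl mulrC.
transitivity (r%:E * lebesgue_measure (`](c - a) / r, (d - a) / r]%classic%R : set RT));
  last by rewrite -E.
rewrite !lebesgue_measure_itv/= !lte_fin ltr_pM2r ?invr_gt0// ltrD2r.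
case: ifPn => _; last by rewrite mule0.
by rewrite -!EFinB -EFinM; congr EFin; field; rewrite gt_eqF.
Qed.

Lemma integral_affine (a r : R) (g : RT -> \bar R) : (0 < r)%R ->
  measurable_fun setT g -> (forall x, 0 <= g x) ->
  \int[lebesgue_measure]_x g (a + r * x)%R
    = r^-1%:E * \int[lebesgue_measure]_x g x.
Proof.
move=> r0 mg g0.
pose f := (fun x : RT => (a + r * x)%R : RT).
have mf : measurable_fun setT f.
  by apply: measurable_funD => //; exact: measurable_funM.
have r'0 : (0 <= r^-1)%R by rewrite invr_ge0 ltW.
pose r' := NngNum r'0.
transitivity (\int[pushforward (@lebesgue_measure R) f]_x g x).
  by rewrite ge0_integral_pushforward.
rewrite -[RHS](ge0_integral_mscale _ measurableT r')//.
by apply: eq_measure_integral => A mA _; exact: lebesgue_measure_affine.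
Qed.

Definition affine_tuple n (a : n.-tuple RT) (r : R) (t : n.-tuple RT)
  : n.-tuple RT := [tuple (tnth a i + r * tnth t i)%R | i < n].

Lemma measurable_affine_tuple n (a : n.-tuple RT) (r : R) :
  measurable_fun setT (affine_tuple a r).
Proof.
apply/measurable_fun_tnthP => i.
rewrite (_ : _ \o _ = (fun t => tnth a i + r * tnth t i)%R).
  apply: measurable_funD => //; apply: measurable_funM => //.
  exact: measurable_tnth.
by apply/funext => t; rewrite /= tnth_mktuple.
Qed.

Lemma affine_tuple_cons n (a : n.+1.-tuple RT) (r x : R) (t : n.-tuple RT) :
  affine_tuple a r (tuple_cons (x, t)) =
  tuple_cons ((thead a + r * x)%R, affine_tuple [tuple of behead a] r t).
Proof.
apply/eq_from_tnth => i; rewrite tnth_mktuple.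
case: (unliftP ord0 i) => [j|] ->; last by rewrite [a]tuple_eta !tnth0 theadE.
by rewrite [in LHS](tuple_eta a) !tnthS tnth_mktuple.
Qed.

Lemma lebesgue_tuple_affine n (a : n.-tuple RT) (r : R) (A : set (n.-tuple RT)) :
  (0 < r)%R -> measurable A ->
  lebesgue_tuple (affine_tuple a r @^-1` A) = (r ^- n)%:E * lebesgue_tuple A.
Proof.
move=> r0; elim: n a A => [|n IH] a A mA.
  rewrite expr0 invr1 mul1e (_ : affine_tuple a r = id) ?preimage_id//.
  by apply/funext => t; rewrite (tuple0 t) [LHS]tuple0.
rewrite !lebesgue_tupleS.
transitivity (\int[lebesgue_measure]_x ((r ^- n)%:E *
    lebesgue_tuple (tsection A (thead a + r * x)%R))).
  apply: eq_integral => x _; rewrite -(IH [tuple of behead a]); last exact: measurable_tsection.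
  by congr lebesgue_tuple; apply/seteqP; split => t; rewrite /tsection/= affine_tuple_cons.
have mS := measurable_fun_tsection mA.
rewrite (integral_affine (thead a) (g := fun x => (r ^- n)%:E * lebesgue_tuple (tsection A x)))//.
- rewrite ge0_integralZl//; last by rewrite lee_fin invr_ge0 exprn_ge0// ltW.
  by rewrite muleA -EFinM -invfM exprS.
- exact: measurable_funeM.
- by move=> x; rewrite mule_ge0// lee_fin invr_ge0 exprn_ge0// ltW.
Qed.
End sections.

(** * The Brunn-Minkowski inequality *)

(** Young's inequality for the conjugate exponents [1/(1 - s)] and [1/s]. *)
Lemma weighted_AMGM {R : realType} (s u v : R) : 0 < s < 1 -> 0 <= u -> 0 <= v ->
  u `^ (1 - s) * v `^ s <= (1 - s) * u + s * v.
Proof.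
move=> /andP[s0 s1] u0 v0; have s1' : 0 < 1 - s by rewrite subr_gt0.
have := @conjugate_powR R (u `^ (1 - s)) (v `^ s) (1 - s)^-1 s^-1
  (powR_ge0 _ _) (powR_ge0 _ _).
rewrite !invr_gt0 => /(_ s1' s0); rewrite !invrK subrK => /(_ erefl).
by rewrite -!powRrM !mulfV ?gt_eqF// !powRr1// [u * _]mulrC [v * _]mulrC.
Qed.

(** * Brunn-Minkowski on the line *)

Section one_dimensional.
Context {R : realType}.
Notation RT := (measurableTypeR R).
Notation mu := (@lebesgue_measure R).
Local Open Scope ereal_scope.

(** A measurable set need not attain its supremum, so a point of [A] within [e] of it is used; the
    part of [A] to its right fits in an interval of length [e]. *)
Lemma lebesgue_measure_cut_right (A : set RT) (c e : R) : measurable A ->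
  A !=set0 -> (forall x, A x -> (`|x| <= c)%R) -> (0 < e)%R ->
  exists2 a, A a & mu A <= mu (A `&` `]-oo, a[%classic) + e%:E.
Proof.
move=> mA A0 Ac e0.
have supA : has_sup A.
  by split=> //; exists c => x /Ac; exact: le_trans (ler_norm _).
have [a Aa ea] := sup_adherent e0 supA.
exists a => //.
have -> : e%:E = mu (`[sup A - e, sup A]%classic : set RT)%R.
  rewrite lebesgue_measure_itv/= lte_fin gtrBl e0 -EFinB; congr EFin.
  by rewrite opprB addrC subrK.
apply: le_trans (measureU2 _ _ _) => //; last exact: measurableI.
apply: le_measure; rewrite ?inE//; first by apply: measurableU => //; exact: measurableI.
move=> x Ax; have [xa|ax] := ltP x a; [left; split => //|right] => /=.
rewrite in_itv/= (le_trans (ltW ea) ax)/=.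
by apply: sup_ubound => //; case: supA.
Qed.

Lemma lebesgue_measure_cut_left (A : set RT) (c e : R) : measurable A ->
  A !=set0 -> (forall x, A x -> (`|x| <= c)%R) -> (0 < e)%R ->
  exists2 a, A a & mu A <= mu (A `&` `[a, +oo[%classic) + e%:E.
Proof.
move=> mA A0 Ac e0.
have infA : has_inf A.
  by split=> //; exists (- c)%R => x /Ac; rewrite ler_norml => /andP[].
have [a Aa ea] := inf_adherent e0 infA.
exists a => //.
have -> : e%:E = mu (`[inf A, inf A + e]%classic : set RT)%R.
  rewrite lebesgue_measure_itv/= lte_fin ltrDl e0 -EFinB; congr EFin.
  by rewrite addrAC subrr add0r.
apply: le_trans (measureU2 _ _ _) => //; last exact: measurableI.
apply: le_measure; rewrite ?inE//; first by apply: measurableU => //; exact: measurableI.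
move=> x Ax; have [ax|xa] := leP a x; [left; split => //|right] => /=.
  by rewrite in_itv/= ax.
rewrite in_itv/= (le_trans (ltW xa) (ltW ea)) andbT.
by apply: inf_lbound => //; case: infA.
Qed.

(** Take [a] near the top of [A] and [b] near the bottom of [B]. The copy [(1 - s) A1 + s b] lies in
    [C] to the left of [p], and the copy [(1 - s) a + s B1] lies in [C] to its right, so their
    measures add up; the cuts lose [e] in total. *)
Lemma brunn_minkowski1 (s c : R) (A B C : set RT) : (0 < s < 1)%R ->
  measurable A -> measurable B -> measurable C -> A !=set0 -> B !=set0 ->
  (forall x, A x -> (`|x| <= c)%R) -> (forall x, B x -> (`|x| <= c)%R) ->
  (forall x y, A x -> B y -> C ((1 - s) * x + s * y)%R) ->
  (1 - s)%:E * mu A + s%:E * mu B <= mu C.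
Proof.
move=> /andP[s0 s1] mA mB mC A0 B0 Ac Bc ABC.
have s1' : (0 < 1 - s)%R by rewrite subr_gt0.
apply/lee_addgt0Pr => e e0.
have [a Aa muA] := lebesgue_measure_cut_right mA A0 Ac e0.
have [b Bb muB] := lebesgue_measure_cut_left mB B0 Bc e0.
set A1 := A `&` _ in muA; set B1 := B `&` _ in muB.
have mA1 : measurable A1 by exact: measurableI.
have mB1 : measurable B1 by exact: measurableI.
pose p := ((1 - s) * a + s * b)%R.
have muAC : (1 - s)%:E * mu A1 <= mu (C `&` `]-oo, p[%classic).
  have := @lebesgue_measure_affine R (- (s * b) / (1 - s)) (1 - s)^-1 A1.
  rewrite invrK invr_gt0 => /(_ s1' mA1) <-; apply: le_measure; rewrite ?inE.
  - apply: preimage_measurable => //.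
    by apply: measurable_funD => //; exact: measurable_funM.
  - exact: measurableI.
  - move=> x [/= Ax]; rewrite in_itv/= => xa; split => /=.
      rewrite (_ : x = (1 - s) * (- (s * b) / (1 - s) + (1 - s)^-1 * x) + s * b)%R.
        exact: ABC.
      by field; rewrite gt_eqF.
    rewrite in_itv/= /p -ltrBlDr.
    move: xa; rewrite -(ltr_pM2l s1'); congr (_ < _)%R.
    by field; rewrite gt_eqF.
have muBC : s%:E * mu B1 <= mu (C `&` `[p, +oo[%classic).
  have := @lebesgue_measure_affine R (- ((1 - s) * a) / s) s^-1 B1.
  rewrite invrK invr_gt0 => /(_ s0 mB1) <-; apply: le_measure; rewrite ?inE.
  - apply: preimage_measurable => //.
    by apply: measurable_funD => //; exact: measurable_funM.
  - exact: measurableI.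
  - move=> x [/= Bx]; rewrite in_itv/= andbT => xb; split => /=.
      rewrite (_ : x = (1 - s) * a + s * (- ((1 - s) * a) / s + s^-1 * x))%R.
        exact: ABC.
      by field; rewrite gt_eqF.
    rewrite in_itv/= andbT /p -lerBrDl.
    suff -> : (x - (1 - s) * a = s * (- ((1 - s) * a) / s + s^-1 * x))%R.
      by rewrite ler_pM2l.
    by field; rewrite gt_eqF.
have -> : mu C = mu (C `&` `]-oo, p[%classic) + mu (C `&` `[p, +oo[%classic).
  rewrite -measureU//; [|exact: measurableI|exact: measurableI|].
    rewrite -setIUr; congr mu; apply/seteqP; split=> [x Cx|x []//]; split => //=.
    by rewrite !in_itv/= andbT; have [|] := ltP x p; [left|right].
  apply/seteqP; split => // x [[_ /=]]; rewrite in_itv/= => xp [_ /=].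
  by rewrite in_itv/= andbT leNgt xp.
have s1e : 0 <= (1 - s)%:E by rewrite lee_fin ltW.
have s0e : 0 <= s%:E by rewrite lee_fin ltW.
apply: (@le_trans _ _ ((1 - s)%:E * (mu A1 + e%:E) + s%:E * (mu B1 + e%:E))).
  by apply: leeD; exact: lee_wpmul2l.
have e0' : 0 <= e%:E by rewrite lee_fin ltW.
rewrite !muleDr ?ge0_adde_def ?inE//.
rewrite addeACA. apply: leeD; first exact: leeD.
by rewrite -!EFinM -EFinD lee_fin -mulrDl subrK mul1r.
Qed.
End one_dimensional.

(** * The Prekopa-Leindler inequality on the line *)

Section prekopa_leindler.
Context {R : realType}.
Notation RT := (measurableTypeR R).
Notation mu := (@lebesgue_measure R).
Local Open Scope ereal_scope.

Lemma measurable_superlevel (f : RT -> R) (t : R) :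
  measurable_fun setT f -> measurable [set x | (t < f x)%R].
Proof.
move=> mf; rewrite (_ : [set x | _] = f @^-1` `]t, +oo[%classic).
  exact: preimage_measurable.
by apply/seteqP; split => x /=; rewrite in_itv/= andbT.
Qed.

(** Fubini on the region below the graph. Truncating at 1 restricts the heights to [t < 1], where
    functions of supremum 1 have nonempty superlevel sets. *)
Lemma layer_cake (f : RT -> R) : measurable_fun setT f -> (forall x, (0 <= f x)%R) ->
  \int[mu]_x (Num.min (f x) 1)%:E = \int[mu]_(t in `[0%R, 1%R[) mu [set x | (t < f x)%R].
Proof.
move=> mf f0.
pose X : set (RT * RT) := (setT `*` `[0, 1[%classic%R) `&` [set p | (p.2 < f p.1)%R].
have mX : measurable X.
  apply: measurableI; first exact: measurableX.
  pose b (p : RT * RT) := (p.2 < f p.1)%R.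
  have : measurable_fun setT b.
    by apply: measurable_fun_ltr => //; exact: measurableT_comp.
  by move=> /(_ measurableT [set true]); rewrite setTI; exact.
transitivity ((mu \x mu) X).
  apply: eq_integral => x _ /=.
  rewrite (_ : xsection X x = `[0, Num.min (f x) 1[%classic%R).
    rewrite lebesgue_measure_itv/= lte_fin lt_min ltr01 andbT.
    have [fx|fx] := ltP 0%R (f x); first by rewrite sube0.
    by rewrite min_l ?(le_trans fx)//; congr EFin; apply/eqP; rewrite eq_le fx f0.
  apply/seteqP; split=> t; rewrite /xsection/= inE /X/= !in_itv/= lt_min.
    by move=> [[_ /andP[-> ->]] ->].
  by move=> /andP[-> /andP[-> ->]].
(* Swaps the order of integration: the two iterated measures agree on rectangles. *)
rewrite (product_measure_unique (m1 := mu) (m2 := mu) (m' := (mu \x^ mu)))//; last first.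
  by move=> A B mA mB; rewrite [LHS]product_measure2E.
rewrite [RHS]integral_mkcond; apply: eq_integral => t _ /=.
rewrite patchE; case: ifPn => [|]; rewrite ?inE ?notin_setE /= => t01.
  congr (mu _); apply/seteqP; split=> x; rewrite /ysection/= inE /X/=; first by case.
  by move=> tf; split.
rewrite (_ : ysection _ _ = set0) ?measure0//; apply/seteqP; split => // x.
by rewrite /ysection/= inE => -[[]].
Qed.
Lemma measurable_fun_superlevel (f : RT -> R) : measurable_fun setT f ->
  measurable_fun setT ((fun t => mu [set x | (t < f x)%R]) : RT -> \bar R).
Proof.
move=> mf; pose X : set (RT * RT) := [set p | (p.2 < f p.1)%R].
have mX : measurable X.
  pose b (p : RT * RT) := (p.2 < f p.1)%R.
  have : measurable_fun setT b.
    by apply: measurable_fun_ltr => //; exact: measurableT_comp.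
  by move=> /(_ measurableT [set true]); rewrite setTI; exact.
rewrite (_ : (fun t => _) = mu \o ysection X); first exact: measurable_fun_ysection.
apply/funext => t /=; congr (mu _).
by apply/seteqP; split=> x; rewrite /ysection/= inE.
Qed.

Lemma integral_scale (k : R) (f : RT -> R) : (0 <= k)%R -> measurable_fun setT f ->
  (forall x, (0 <= f x)%R) ->
  \int[mu]_x (k * f x)%:E = k%:E * \int[mu]_x (f x)%:E.
Proof.
move=> k0 mf f0; rewrite -ge0_integralZl//; first exact/measurable_EFinP.
by move=> x _; rewrite lee_fin.
Qed.

(** Dividing by the supremum [F] makes every superlevel set below height 1 nonempty, as the
    one-dimensional inequality demands; the positive integral excludes [F <= 0]. *)
Lemma superlevel_sup (f : RT -> R) (M a : R) : (forall x, 0 <= f x <= M)%R ->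
  \int[mu]_x (f x)%:E = a%:E -> (0 < a)%R ->
  exists F, [/\ (0 < F)%R, forall x, (F^-1 * f x <= 1)%R &
    forall t, (t < 1)%R -> exists x, (t < F^-1 * f x)%R].
Proof.
move=> f0M fa a0; pose F := sup (range f).
have hs : has_sup (range f).
  by split; [exists (f 0%R), 0%R|exists M => _ [x _ <-]; case/andP: (f0M x)].
have fF x : (f x <= F)%R by apply: sup_ubound; [case: hs|exists x].
have F0 : (0 < F)%R.
  rewrite ltNge; apply/negP => F0; move: a0.
  rewrite -lte_fin -fa integral0_eq ?ltxx// => x _; congr EFin.
  by apply/eqP; rewrite eq_le (le_trans (fF x))//; case/andP: (f0M x).
exists F; split => // [x|t t1]; first by rewrite ler_pdivrMl// mulr1.
have : (0 < F - t * F)%R by rewrite subr_gt0 gtr_pMl.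
move=> /sup_adherent/(_ hs)[_ [x _ <-]]; rewrite opprB addrCA subrr addr0 => tF.
by exists x; rewrite ltr_pdivlMl// mulrC.
Qed.

(** After normalisation, [(1 - s) {f > t} + s {g > t}] lies in [{h > t}]. The one-dimensional
    inequality integrated over [t] bounds the integral of [h] by an arithmetic mean, and the
    weighted AM-GM inequality turns this into the geometric one. The bound [c] on the supports makes
    the superlevel sets bounded. *)
Lemma prekopa_leindler1 (s c M a b : R) (f g h : RT -> R) : (0 < s < 1)%R ->
  measurable_fun setT f -> measurable_fun setT g -> measurable_fun setT h ->
  (forall x, 0 <= f x <= M)%R -> (forall x, 0 <= g x <= M)%R ->
  (forall x, 0 <= h x)%R ->
  (forall x, c < `|x| -> f x = 0)%R -> (forall x, c < `|x| -> g x = 0)%R ->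
  (forall x y, f x `^ (1 - s) * g y `^ s <= h ((1 - s) * x + s * y))%R ->
  \int[mu]_x (f x)%:E = a%:E -> \int[mu]_x (g x)%:E = b%:E ->
  (a `^ (1 - s) * b `^ s)%:E <= \int[mu]_x (h x)%:E.
Proof.
move=> s01 mf mg mh f0 g0 h0 fc gc fgh fa gb.
have /andP[s0 s1] := s01; have s1' : (0 < 1 - s)%R by rewrite subr_gt0.
have intge0 : 0 <= \int[mu]_x (h x)%:E by apply: integral_ge0 => x _; rewrite lee_fin.
have a0 : (0 <= a)%R.
  by rewrite -lee_fin -fa; apply: integral_ge0 => x _; rewrite lee_fin; case/andP: (f0 x).
have b0 : (0 <= b)%R.
  by rewrite -lee_fin -gb; apply: integral_ge0 => x _; rewrite lee_fin; case/andP: (g0 x).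
(* A vanishing integral makes the left side 0, because [0] to a nonzero power is [0]. *)
have [->|an0] := eqVneq a 0%R; first by rewrite powR0 ?gt_eqF// mul0r.
have [->|bn0] := eqVneq b 0%R; first by rewrite (powR0 (x := s)) ?gt_eqF// mulr0.
have {an0}agt0 : (0 < a)%R by rewrite lt_neqAle eq_sym an0.
have {bn0}bgt0 : (0 < b)%R by rewrite lt_neqAle eq_sym bn0.
have [F [F0 fF Ft]] := superlevel_sup f0 fa agt0.
have [G [G0 gG Gt]] := superlevel_sup g0 gb bgt0.
have F'0 : (0 <= F^-1)%R by rewrite invr_ge0 ltW.
have G'0 : (0 <= G^-1)%R by rewrite invr_ge0 ltW.
have mf1 : measurable_fun setT (fun x => F^-1 * f x)%R by exact: measurable_funM.
have mg1 : measurable_fun setT (fun x => G^-1 * g x)%R by exact: measurable_funM.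
(* The scale of [h] forced by those of [f] and [g]; it cancels at the end. *)
pose H := (F `^ (1 - s) * G `^ s)%R.
have H0 : (0 < H)%R by rewrite mulr_gt0// powR_gt0.
have H'0 : (0 <= H^-1)%R by rewrite invr_ge0 ltW.
have mh1 : measurable_fun setT (fun x => H^-1 * h x)%R by exact: measurable_funM.
have f1ge x : (0 <= F^-1 * f x)%R by rewrite mulr_ge0//; case/andP: (f0 x).
have g1ge x : (0 <= G^-1 * g x)%R by rewrite mulr_ge0//; case/andP: (g0 x).
have h1ge x : (0 <= H^-1 * h x)%R by rewrite mulr_ge0.
have s1e : 0 <= (1 - s)%:E by rewrite lee_fin ltW.
have s0e : 0 <= s%:E by rewrite lee_fin ltW.
have fgh1 x y t : (0 <= t -> t < F^-1 * f x -> t < G^-1 * g y ->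
    t < H^-1 * h ((1 - s) * x + s * y))%R.
  move=> t0 tf tg.
  have : ((F^-1 * f x) `^ (1 - s) * (G^-1 * g y) `^ s <= H^-1 * h ((1 - s) * x + s * y))%R.
    have /andP[? _] := f0 x; have /andP[? _] := g0 y.
    rewrite !powRM// mulrACA ler_pM ?mulr_ge0 ?powR_ge0// /H invfM.
    by rewrite -!powRN -!powR_inv1 ?(ltW F0) ?(ltW G0)// -!powRrM !mulN1r.
  apply: lt_le_trans.
  pose m := Num.min (F^-1 * f x)%R (G^-1 * g y)%R.
  have tm : (t < m)%R by rewrite lt_min tf.
  have m0 : (0 < m)%R by apply: le_lt_trans tm.
  apply: (lt_le_trans tm).
  have -> : (m = m `^ (1 - s) * m `^ s)%R.
    by rewrite -powRD ?subrK ?powRr1 ?(ltW m0)// (gt_eqF m0) implybT.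
  by rewrite ler_pM ?powR_ge0// ge0_ler_powR ?nnegrE
    ?(ltW s1') ?(ltW s0) ?(ltW m0)// ge_min lexx ?orbT.
have BM (t : RT) : `[0%R, 1%R[%classic t ->
    (1 - s)%:E * mu [set x | (t < F^-1 * f x)%R] +
    s%:E * mu [set x | (t < G^-1 * g x)%R] <= mu [set x | (t < H^-1 * h x)%R].
  rewrite /= in_itv/= => /andP[t0 t1].
  apply: (@brunn_minkowski1 _ s c) => //; try exact: measurable_superlevel.
  - by have [x] := Ft _ t1; exists x.
  - by have [x] := Gt _ t1; exists x.
  - by move=> x; rewrite leNgt; apply: contraPN => /fc /= ->; rewrite mulr0 ltNge t0.
  - by move=> x; rewrite leNgt; apply: contraPN => /gc /= ->; rewrite mulr0 ltNge t0.
  - by move=> x y /= tf tg; exact: fgh1.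
have mI01 : measurable (`[0%R, 1%R[%classic : set RT) by [].
have msub (u : RT -> R) : measurable_fun setT u -> measurable_fun (`[0%R, 1%R[%classic : set RT)
    ((fun t => mu [set x | (t < u x)%R]) : RT -> \bar R).
  by move=> mu'; apply: measurable_funS (measurable_fun_superlevel mu').
(* Truncation at 1 can only lower the integral of [h / H], and it leaves [f / F] and [g / G]
   unchanged since they are at most 1. *)
have key : (1 - s)%:E * (F^-1 * a)%:E + s%:E * (G^-1 * b)%:E <= H^-1%:E * \int[mu]_x (h x)%:E.
  rewrite -integral_scale//.
  apply: (@le_trans _ _ (\int[mu]_x (Num.min (H^-1 * h x) 1)%:E)); last first.
    apply: ge0_le_integral => //.
    - by move=> x _; rewrite lee_fin le_min h1ge ler01.
    - by apply/measurable_EFinP; exact: measurable_minr.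
    - exact/measurable_EFinP.
    - by move=> x _; rewrite lee_fin ge_min lexx.
  rewrite (EFinM _ a) (EFinM _ b) -fa -gb.
  rewrite -(integral_scale F'0 mf); last by move=> x; case/andP: (f0 x).
  rewrite -(integral_scale G'0 mg); last by move=> x; case/andP: (g0 x).
  rewrite [X in _ * X + _](_ : _ = \int[mu]_x (Num.min (F^-1 * f x) 1)%:E); last first.
    by apply: eq_integral => x _; rewrite min_l.
  rewrite [X in _ + _ * X](_ : _ = \int[mu]_x (Num.min (G^-1 * g x) 1)%:E); last first.
    by apply: eq_integral => x _; rewrite min_l.
  rewrite !layer_cake// -!ge0_integralZl//; try exact: msub.
  rewrite -ge0_integralD//; try by apply: measurable_funeM; exact: msub.
  - apply: ge0_le_integral => //.
    + by move=> t _; rewrite adde_ge0// mule_ge0.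
    + by apply: emeasurable_funD; apply: measurable_funeM; exact: msub.
    + exact: msub.
  - by move=> t _; rewrite mule_ge0.
  - by move=> t _; rewrite mule_ge0.
have : ((F^-1 * a) `^ (1 - s) * (G^-1 * b) `^ s)%:E <= H^-1%:E * \int[mu]_x (h x)%:E.
  apply: le_trans key; rewrite -!EFinM -EFinD lee_fin.
  by apply: weighted_AMGM => //; rewrite mulr_ge0.
move=> /(lee_wpmul2l (x := H%:E)); rewrite lee_fin => /(_ (ltW H0)).
rewrite muleA -!EFinM mulfV ?gt_eqF// mul1e; apply: le_trans; rewrite lee_fin.
rewrite /H mulrACA -!powRM ?(ltW F0) ?(ltW G0)//; try exact: mulr_ge0.
by rewrite !mulrA !mulfV ?gt_eqF// !mul1r.
Qed.
End prekopa_leindler.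

(** * Induction on the dimension *)

Section brunn_minkowski.
Context {R : realType}.
Notation RT := (measurableTypeR R).
Notation mu := (@lebesgue_measure R).

Definition tuple_cube n (c : R) : set (n.-tuple RT) :=
  [set t | forall i, `|tnth t i| <= c].
Arguments tuple_cube : clear implicits.

Lemma tsection_cube_in n (c x : R) : `|x| <= c ->
  tsection (tuple_cube n.+1 c) x = tuple_cube n c.
Proof.
move=> xc; apply/seteqP; split=> t /= tc i.
  by have := tc (lift ord0 i); rewrite /tuple_cons tnthS.
by case: (unliftP ord0 i) => [j|] ->; rewrite /tuple_cons ?tnthS ?tnth0.
Qed.

Lemma tsection_cube_out n (A : set (n.+1.-tuple RT)) (c x : R) :
  A `<=` tuple_cube n.+1 c -> c < `|x| -> tsection A x = set0.
Proof.
move=> Ac cx; apply/seteqP; split => // t /Ac /(_ ord0).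
by rewrite /tuple_cons tnth0 leNgt cx.
Qed.

Lemma tsection_cube_sub n (A : set (n.+1.-tuple RT)) (c x : R) :
  A `<=` tuple_cube n.+1 c -> tsection A x `<=` tuple_cube n c.
Proof.
by move=> Ac t /Ac tc i; have := tc (lift ord0 i); rewrite /tuple_cons tnthS.
Qed.

Lemma measurable_tuple_cube n (c : R) : measurable (tuple_cube n c).
Proof.
rewrite (_ : tuple_cube n c =
    \bigcap_(i in [set: 'I_n]) ((@tnth n RT)^~ i @^-1` `[-c, c]%classic)).
  apply: fin_bigcap_measurable; first exact: finite_finset.
  by move=> i _; apply: preimage_measurable => //; exact: measurable_tnth.
apply/seteqP; split=> t /= tc i; first by move=> _ /=; rewrite in_itv/= -ler_norml.
by have := tc i Logic.I; rewrite /= in_itv/= -ler_norml.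
Qed.

Lemma lebesgue_tuple_cube n (c : R) : 0 <= c ->
  lebesgue_tuple (tuple_cube n c) = ((2 * c) ^+ n)%:E.
Proof.
move=> c0; elim: n => [|n IH].
  rewrite expr0 /= diracE mem_set//.
  by case.
rewrite lebesgue_tupleS.
transitivity (\int[mu]_(x in `[(-c)%R, c]) ((2 * c) ^+ n)%:E)%E.
  rewrite [RHS]integral_mkcond; apply: eq_integral => x _; rewrite patchE.
  case: ifPn; rewrite ?inE ?notin_setE/= in_itv/= -ler_norml => xc.
    by rewrite tsection_cube_in.
  rewrite (@tsection_cube_out _ _ c) ?measure0//.
  by rewrite ltNge; exact/negP.
rewrite integral_cst//= lebesgue_measure_itv/= lte_fin.
rewrite exprSr; case: ifPn => [_|]; first by rewrite -EFinB -EFinM opprK -mulr2n mulr_natl.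
rewrite -leNgt => cc; have -> : c = 0 by apply/eqP; rewrite eq_le; lra.
by rewrite !mulr0 mule0.
Qed.

Lemma lebesgue_tuple_sub_cube n (A : set (n.-tuple RT)) (c : R) : measurable A ->
  0 <= c -> A `<=` tuple_cube n c -> (lebesgue_tuple A <= ((2 * c) ^+ n)%:E)%E.
Proof.
move=> mA c0 Ac; rewrite -lebesgue_tuple_cube//; apply: le_measure; rewrite ?inE//.
exact: measurable_tuple_cube.
Qed.

Lemma fin_num_sub_cube n (A : set (n.-tuple RT)) (c : R) : measurable A ->
  0 <= c -> A `<=` tuple_cube n c -> lebesgue_tuple A \is a fin_num.
Proof.
move=> mA c0 Ac; rewrite ge0_fin_numE//.
by apply: le_lt_trans (lebesgue_tuple_sub_cube mA c0 Ac) _; rewrite ltry.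
Qed.

Lemma lebesgue_tuple0E (A : set (0.-tuple RT)) :
  lebesgue_tuple A = (([tuple] \in A)%:R)%:E.
Proof. exact: diracE. Qed.

Definition tuple_conv n (s : R) (t u : n.-tuple RT) : n.-tuple RT :=
  [tuple (1 - s) * tnth t i + s * tnth u i | i < n].

Lemma tuple_conv_cons n (s x y : R) (t u : n.-tuple RT) :
  tuple_conv s (tuple_cons (x, t)) (tuple_cons (y, u)) =
  tuple_cons ((1 - s) * x + s * y, tuple_conv s t u).
Proof.
apply/eq_from_tnth => i; rewrite tnth_mktuple /tuple_cons.
by case: (unliftP ord0 i) => [j|] ->; rewrite ?tnthS ?tnth_mktuple ?tnth0.
Qed.

(** By induction the slice volumes of [A], [B] and [C] satisfy the hypothesis of Prekopa-Leindler,
    and the integral of the slice volumes is the volume. The cube bounds slices and supports at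
    once, and makes every use of [fine] harmless. *)
Lemma brunn_minkowski_mul n (s c : R) (A B C : set (n.-tuple RT)) :
  0 < s < 1 -> 0 <= c -> measurable A -> measurable B -> measurable C ->
  A `<=` tuple_cube n c -> B `<=` tuple_cube n c -> C `<=` tuple_cube n c ->
  (forall t u, A t -> B u -> C (tuple_conv s t u)) ->
  fine (lebesgue_tuple A) `^ (1 - s) * fine (lebesgue_tuple B) `^ s
    <= fine (lebesgue_tuple C).
Proof.
move=> s01 c0; have /andP[s0 s1] := s01.
elim: n A B C => [|n IH] A B C mA mB mC Ac Bc Cc ABC.
  (* In dimension 0 the measure is a Dirac mass; if [A] or [B] is empty, the left side is [0] to a
     positive power. *)
  rewrite !lebesgue_tuple0E /=.
  have [At|At] := boolP ([tuple] \in A); last first.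
    by rewrite powR0 ?mul0r ?ler0n// gt_eqF// subr_gt0.
  have [Bt|Bt] := boolP ([tuple] \in B); last first.
    by rewrite [X in _ * X]powR0 ?mulr0 ?ler0n// gt_eqF.
  rewrite !powR1 mulr1 mem_set//; rewrite !inE in At Bt.
  by have := ABC _ _ At Bt; rewrite [tuple_conv _ _ _]tuple0.
have finS (X : set (n.+1.-tuple RT)) x : measurable X -> X `<=` tuple_cube n.+1 c ->
    lebesgue_tuple (tsection X x) \is a fin_num.
  move=> mX Xc; apply: (fin_num_sub_cube (measurable_tsection x mX) c0).
  exact: tsection_cube_sub.
pose v (X : set (n.+1.-tuple RT)) (x : RT) : R := fine (lebesgue_tuple (tsection X x)).
have mv X : measurable X -> measurable_fun setT (v X).
  by move=> mX; apply: measurableT_comp => //; exact: measurable_fun_tsection.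
have vE X : measurable X -> X `<=` tuple_cube n.+1 c ->
    (\int[mu]_x (v X x)%:E)%E = (fine (lebesgue_tuple X))%:E.
  move=> mX Xc; rewrite fineK ?(fin_num_sub_cube mX c0 Xc)// lebesgue_tupleS.
  by apply: eq_integral => x _; rewrite /v fineK// finS.
have v0 X x : 0 <= v X x by rewrite fine_ge0.
have vM X : measurable X -> X `<=` tuple_cube n.+1 c -> forall x, 0 <= v X x <= (2 * c) ^+ n.
  move=> mX Xc x; rewrite v0/= -lee_fin /v fineK ?finS//.
  apply: (lebesgue_tuple_sub_cube (measurable_tsection x mX) c0).
  exact: tsection_cube_sub.
have vc X : X `<=` tuple_cube n.+1 c -> forall x, c < `|x| -> v X x = 0.
  by move=> Xc x cx; rewrite /v (tsection_cube_out Xc)// measure0.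
have := @prekopa_leindler1 R s c ((2 * c) ^+ n) _ _ (v A) (v B) (v C) s01 (mv _ mA)
  (mv _ mB) (mv _ mC) (vM _ mA Ac) (vM _ mB Bc) (v0 C)
  (vc _ Ac) (vc _ Bc) _ (vE _ mA Ac) (vE _ mB Bc).
rewrite vE// lee_fin; apply => x y.
apply: IH; try exact: measurable_tsection; try exact: tsection_cube_sub.
move=> t u At Bu; rewrite /tsection/= -tuple_conv_cons; exact: ABC.
Qed.
End brunn_minkowski.

(** * Euclidean geometry and polytope approximation *)

Section euclidean.
Context {R : realType} {n : nat}.
Implicit Types (x y u v : 'rV[R]_n) (A B L : set 'rV[R]_n).

Lemma dotpC x y : dotp x y = dotp y x.
Proof. by apply: eq_bigr => i _; rewrite mulrC. Qed.

Lemma dotpDl x y z : dotp (x + y) z = dotp x z + dotp y z.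
Proof. by rewrite -big_split; apply: eq_bigr => i _; rewrite mxE mulrDl. Qed.

Lemma dotpZl a x z : dotp (a *: x) z = a * dotp x z.
Proof. by rewrite /dotp mulr_sumr; apply: eq_bigr => i _; rewrite mxE mulrA. Qed.

Lemma dotpNl x z : dotp (- x) z = - dotp x z.
Proof. by rewrite -scaleN1r dotpZl mulN1r. Qed.

Lemma dotpBl x y z : dotp (x - y) z = dotp x z - dotp y z.
Proof. by rewrite dotpDl dotpNl. Qed.

Lemma dotpDr x y z : dotp z (x + y) = dotp z x + dotp z y.
Proof. by rewrite dotpC dotpDl !(dotpC z). Qed.

Lemma dotpZr a x z : dotp z (a *: x) = a * dotp z x.
Proof. by rewrite dotpC dotpZl dotpC. Qed.

Lemma dotpNr x z : dotp z (- x) = - dotp z x.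
Proof. by rewrite dotpC dotpNl dotpC. Qed.

Lemma dotpBr x y z : dotp z (x - y) = dotp z x - dotp z y.
Proof. by rewrite dotpDr dotpNr. Qed.

Lemma dotp_ge0 x : 0 <= dotp x x.
Proof. by apply: sumr_ge0 => i _; rewrite -expr2 sqr_ge0. Qed.

Lemma dotp_eq0 x : dotp x x = 0 -> x = 0.
Proof.
move=> /eqP; rewrite psumr_eq0; last by move=> i _; rewrite -expr2 sqr_ge0.
move=> /allP x0; apply/rowP => i; rewrite mxE.
have := x0 i; rewrite mem_index_enum => /(_ isT) /=.
by rewrite -expr2 sqrf_eq0 => /eqP.
Qed.

Lemma enorm_ge0 x : 0 <= enorm x.
Proof. exact: sqrtr_ge0. Qed.

Lemma sqr_enorm x : enorm x ^+ 2 = dotp x x.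
Proof. by rewrite sqr_sqrtr// dotp_ge0. Qed.

Lemma enorm_eq0 x : enorm x = 0 -> x = 0.
Proof. by move=> x0; apply: dotp_eq0; rewrite -sqr_enorm x0 expr0n. Qed.

Lemma enorm0 : enorm (0 : 'rV[R]_n) = 0.
Proof. by rewrite /enorm /dotp big1 ?sqrtr0// => i _; rewrite mxE mul0r. Qed.

Lemma enormZ a x : enorm (a *: x) = `|a| * enorm x.
Proof.
by rewrite /enorm dotpZl dotpZr mulrA -expr2 sqrtrM ?sqr_ge0// sqrtr_sqr.
Qed.

Lemma enormN x : enorm (- x) = enorm x.
Proof. by rewrite -scaleN1r enormZ normrN1 mul1r. Qed.

Lemma dotp_le x y : dotp x y <= enorm x * enorm y.
Proof.
have [x0|x0] := eqVneq (enorm x) 0.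
  rewrite (enorm_eq0 x0) enorm0 mul0r /dotp big1// => i _; by rewrite mxE mul0r.
have [y0|y0] := eqVneq (enorm y) 0.
  rewrite (enorm_eq0 y0) enorm0 mulr0 /dotp big1// => i _; by rewrite mxE mulr0.
have xgt0 : 0 < enorm x by rewrite lt_neqAle eq_sym x0 enorm_ge0.
have ygt0 : 0 < enorm y by rewrite lt_neqAle eq_sym y0 enorm_ge0.
have := dotp_ge0 (enorm y *: x - enorm x *: y).
rewrite dotpBl !dotpBr !dotpZl !dotpZr -!sqr_enorm (dotpC y x).
have : 0 < enorm x * enorm y by rewrite mulr_gt0.
set a := enorm x; set b := enorm y; set c := dotp x y => ab0 h.
have {}h : 0 <= 2 * (a * b) * (a * b - c)
  by apply: le_trans h _; rewrite le_eqVlt; apply/orP; left; apply/eqP; ring.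
by move: h; rewrite pmulr_rge0 ?subr_ge0// mulr_gt0.
Qed.

Lemma enormD x y : enorm (x + y) <= enorm x + enorm y.
Proof.
rewrite -(@ler_pXn2r _ 2)// ?nnegrE ?addr_ge0 ?enorm_ge0//.
rewrite sqr_enorm dotpDl !dotpDr sqrrD !sqr_enorm (dotpC y x) mulr2n.
have := dotp_le x y; lra.
Qed.

Lemma coord_le_enorm x i : `|x 0 i| <= enorm x.
Proof.
rewrite -(@ler_pXn2r _ 2)// ?nnegrE ?enorm_ge0//.
rewrite sqr_enorm real_normK ?num_real// /dotp (bigD1 i)//= -expr2 lerDl.
by apply: sumr_ge0 => j _; rewrite -expr2 sqr_ge0.
Qed.

Lemma continuous_dotp u : continuous (fun x => dotp x u).
Proof.
apply: (continuous_big (U := R) (op := +%R)) => [|i _ x]; first exact: add_continuous.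
have c := @coord_continuous R 1 n 0 i x.
by apply: continuousM; [exact: c|exact: cst_continuous].
Qed.

Lemma continuous_enorm : continuous (@enorm R n).
Proof.
move=> x; apply: (continuous_comp (f := fun y : 'rV[R]_n => dotp y y)); last exact: sqrt_continuous.
move: x; apply: (continuous_big (U := R) (op := +%R)) => [|i _ x]; first exact: add_continuous.
have c := @coord_continuous R 1 n 0 i x.
by apply: continuousM; exact: c.
Qed.
End euclidean.

(** * Compactness, parallel bodies and separation *)

Section parallel_bodies.
Context {R : realType} {n : nat}.
Implicit Types (x y z u v : 'rV[R]_n) (A B K L : set 'rV[R]_n).

Definition convex_in L := forall x y (s : R), L x -> L y -> 0 <= s <= 1 ->
  L ((1 - s) *: x + s *: y).

Lemma convex_body_convex_in L : convex_body L -> convex_in L.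
Proof.
move=> [_ _ cL] x y s Lx Ly /andP[s0 s1].
have s'0 : 0 <= 1 - s by rewrite subr_ge0.
have s'1 : 1 - s <= 1 by rewrite gerBl.
(* The convex combination of the convexity structure puts its parameter on the first point, hence
   the parameter [1 - s]. *)
have := cL x y (Itv01 s'0 s'1); rewrite !inE => /(_ Lx Ly).
by rewrite /conv/= /unstable.onem opprB addrCA subrr addr0.
Qed.

Definition coord_cube (c : R) : set 'rV[R]_n := [set x | forall i, `|x 0 i| <= c].

Lemma compact_coord_cube (c : R) : compact (coord_cube c).
Proof.
rewrite (_ : coord_cube c = [set x | forall i, `[- c, c]%classic (x ord0 i)]).
  apply: (@rV_compact R n (fun=> `[- c, c]%classic)) => _.
  exact: segment_compact.
by apply/seteqP; split=> x /= xc i; have := xc i; rewrite /= in_itv/= ler_norml.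
Qed.

Lemma compact_sub_coord_cube A : compact A -> exists2 c, 0 <= c & A `<=` coord_cube c.
Proof.
move=> /compact_bounded[M [_ MA]].
exists (`|M| + 1); first by rewrite addr_ge0.
move=> x Ax i.
have /MA MA1 : M < `|M| + 1 by rewrite (le_lt_trans (ler_norm _))// ltrDl.
apply: le_trans (MA1 x Ax); rewrite [leRHS]/Num.norm/= mx_normrE.
exact: (le_bigmax _ (fun ij : 'I_1 * 'I_n => `|x ij.1 ij.2|) (0, i)).
Qed.

Lemma compact_enorm_bounded A : compact A ->
  exists2 r : R, 0 <= r & forall x, A x -> enorm x <= r.
Proof.
move=> cA; have [A0|/set0P A0] := eqVneq A set0.
  by exists 0 => // x; rewrite A0.
have [] := @EVT_max_rV R n (@enorm R n) A A0 cA.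
  exact: continuous_subspaceT continuous_enorm.
move=> p pA pmax; exists (enorm p); first exact: enorm_ge0.
by move=> x Ax; apply: pmax; rewrite inE.
Qed.

Lemma compact_enorm_le (r : R) : compact [set x : 'rV[R]_n | enorm x <= r].
Proof.
apply: (@subclosed_compact _ _ (coord_cube r));
  [|exact: compact_coord_cube|move=> x /= xr i].
  by have /continuous_closedP := @continuous_enorm R n => /(_ _ (@closed_le R r)).
exact: le_trans (coord_le_enorm x i) xr.
Qed.

Lemma compact_unit_sphere : compact (@unit_sphere R n).
Proof.
apply: (@subclosed_compact _ _ [set x : 'rV[R]_n | enorm x <= 1]);
  [|exact: compact_enorm_le|by move=> x /= ->].
by have /continuous_closedP := @continuous_enorm R n => /(_ _ (@closed_eq R 1)).
Qed.

Lemma dilate_unit_ball (e : R) : 0 <= e -> dilate e (@unit_ball R n) = [set x | enorm x <= e].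
Proof.
move=> e0; apply/seteqP; split=> x /=.
  by move=> [y yB <-]; rewrite enormZ ger0_norm// ler_piMr.
have [e_eq0 xe|en0 xe] := eqVneq e 0.
  exists 0; first by rewrite /unit_ball/= enorm0.
  rewrite scaler0; apply/esym/enorm_eq0/eqP.
  by rewrite eq_le enorm_ge0 andbT -e_eq0.
have {e0 en0} e0 : 0 < e by rewrite lt_neqAle eq_sym en0.
exists (e^-1 *: x); last by rewrite scalerA mulfV ?gt_eqF// scale1r.
by rewrite /unit_ball/= enormZ gtr0_norm ?invr_gt0// ler_pdivrMl// mulr1.
Qed.

Definition outer_parallel L (e : R) := minkowski_sum L (dilate e unit_ball).

Lemma outer_parallelP L (e : R) x : 0 <= e ->
  outer_parallel L e x <-> exists2 y, L y & enorm (x - y) <= e.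
Proof.
move=> e0; rewrite /outer_parallel dilate_unit_ball//; split=> [[y Ly [b be <-]]|[y Ly xye]].
  by exists y => //; rewrite addrC addKr.
by exists y => //; exists (x - y) => //; rewrite addrCA subrr addr0.
Qed.

Lemma inner_parallelP K (l : R) x :
  inner_parallel K l x <-> forall b, enorm b <= `|l| -> K (x + b).
Proof.
rewrite /inner_parallel /translate dilate_unit_ball//; split => /= [Kx b bl|Kx y [b bl <-]].
  by apply: Kx; exists b.
exact: Kx.
Qed.

(** [p] is the point of [L] nearest to [z], and [u] is the unit direction from [p] to [z]. *)
Lemma separation L z : L !=set0 -> compact L -> convex_in L -> ~ L z ->
  exists p u (d : R), [/\ L p, enorm u = 1, 0 < d, z = p + d *: u &
    forall y, L y -> dotp y u <= dotp p u].
Proof.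
move=> L0 cL vL Lz.
have [] := @EVT_min_rV R n (fun y => enorm (y - z)) L L0 cL.
  apply: continuous_subspaceT => y.
  apply: (continuous_comp (f := fun y : 'rV[R]_n => y - z)); last exact: continuous_enorm.
  by apply: continuousB => //; exact: cst_continuous.
move=> p; rewrite inE => Lp pmin.
pose d := enorm (z - p).
have d0 : 0 < d.
  rewrite lt_neqAle enorm_ge0 andbT eq_sym; apply/eqP => /enorm_eq0/eqP.
  by rewrite subr_eq0 => /eqP zp; apply: Lz; rewrite zp.
exists p, (d^-1 *: (z - p)), d; split => //.
- by rewrite enormZ gtr0_norm ?invr_gt0// mulVf ?gt_eqF.
- by rewrite scalerA mulfV ?gt_eqF// scale1r addrCA subrr addr0.
move=> y Ly; rewrite !dotpZr ler_pM2l ?invr_gt0// -subr_le0 -dotpBl.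
(* first variation of the distance along the segment from p to y *)
have var (t : R) : 0 < t <= 1 -> 2 * dotp (y - p) (z - p) <= t * enorm (y - p) ^+ 2.
  move=> /andP[t0 t1].
  have /pmin : (1 - t) *: p + t *: y \in L by rewrite inE; apply: vL => //; rewrite ltW.
  rewrite -(@ler_pXn2r _ 2)// ?nnegrE ?enorm_ge0//.
  have -> : (1 - t) *: p + t *: y - z = t *: (y - p) - (z - p).
    rewrite scalerBl scale1r scalerBr opprB addrAC [in RHS]addrC addrA addrAC -!addrA.
    by congr (_ + _); rewrite addrCA [RHS]addrCA; congr (_ + _); rewrite addrC.
  rewrite -(enormN (p - z)) opprB !sqr_enorm.
  move: (y - p) (z - p) => a b; rewrite dotpBl !dotpBr !dotpZl !dotpZr (dotpC b a) => h.
  have {}h : 0 <= t * (t * dotp a a - 2 * dotp a b) by lra.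
  by move: h; rewrite pmulr_rge0// subr_ge0.
rewrite leNgt; apply/negP => g0.
set g := dotp _ _ in var g0; set e := enorm (y - p) ^+ 2 in var.
have e0 : 0 <= e by rewrite sqr_ge0.
(* If the inner product [g] were positive, [t = 1] (for [e <= g]) or the minimising [t = g / e]
   would contradict the variation inequality. *)
have [eg|ge] := leP e g.
  have := var 1; rewrite ltr01 lexx => /(_ isT); lra.
have e0' : 0 < e by apply: lt_trans ge.
have := var (g / e); rewrite divr_gt0// ler_pdivrMr// mul1r ltW// => /(_ isT).
rewrite divfK ?gt_eqF//; lra.
Qed.
End parallel_bodies.

(** * Circumscribed polytopes *)

Section polytope_approximation.
Context {R : realType} {n : nat}.
Implicit Types (x y z u v : 'rV[R]_n) (A B K L : set 'rV[R]_n).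

(** Cancellation of balls: if [x + d B] lies in [L + k B], then [x + (d - k) B] lies in [L]. If
    [x + b] were outside [L], with separating normal [u], the point [x + d u] would be farther than
    [k] from [L]. *)
Lemma outer_parallel_cancel L x (d k : R) :
  L !=set0 -> compact L -> convex_in L -> 0 <= k ->
  (forall b, enorm b <= d -> exists2 y, L y & enorm (x + b - y) <= k) ->
  forall b, enorm b <= d - k -> L (x + b).
Proof.
move=> L0 cL vL k0 xd b bdk; apply: contrapT => Lxb.
have [p [u [e [Lp u1 e0 xbE pu]]]] := separation L0 cL vL Lxb.
have d0 : 0 <= d.
  by have := le_trans (enorm_ge0 b) bdk; rewrite subr_ge0; exact: le_trans.
have /xd[y Ly xy] : enorm (d *: u) <= d by rewrite enormZ u1 mulr1 ger0_norm.
have uu : dotp u u = 1 by rewrite -sqr_enorm u1 expr1n.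
have h1 := dotp_le (x + d *: u - y) u.
have h2 := pu y Ly.
have h3 := dotp_le b u.
have h4 : dotp (x + b) u = dotp p u + e by rewrite xbE dotpDl dotpZl uu mulr1.
move: h1 h3 h4; rewrite u1 !mulr1 dotpBl !dotpDl dotpZl uu mulr1.
lra.
Qed.

Lemma unit_sphere_net (e : R) : 0 < e -> exists s : seq 'rV[R]_n,
  (forall u, u \in s -> enorm u = 1) /\
  forall u, enorm u = 1 -> exists2 v, v \in s & enorm (u - v) <= e.
Proof.
move=> e0; have := @compact_unit_sphere R n; rewrite compact_cover.
pose f (v : 'rV[R]_n) := [set u : 'rV[R]_n | enorm (u - v) < e].
have fo v : unit_sphere v -> open (f v).
  move=> _; have c : continuous (fun u : 'rV[R]_n => enorm (u - v)).
    move=> y; apply: (continuous_comp (f := fun y : 'rV[R]_n => y - v)).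
      by apply: continuousB => //; exact: cst_continuous.
    exact: continuous_enorm.
  by move/continuousP : c => /(_ _ (@open_lt R e)).
move=> /(_ _ _ _ fo)[u u1|D DS Dc].
  by exists u => //; rewrite /f/= subrr enorm0.
exists (finmap.enum_fset D); split=> [u uD|u u1]; first by have /set_mem := DS u uD.
by have [v vD uv] := Dc u u1; exists v => //; exact: ltW.
Qed.

Definition polytope N (u : 'I_N -> 'rV[R]_n) (h : 'I_N -> R) : set 'rV[R]_n :=
  [set x | forall i, dotp x (u i) <= h i].

(** The normals form a finite net of the sphere and the offsets are the support values of [L]. A
    point of the polytope outside [L] is [p + d u]; testing it against a net vector [v] close to [u]
    bounds [d]. *)
Lemma circumscribed_polytope L (k : R) : L !=set0 -> compact L -> convex_in L ->
  0 < k -> exists N (u : 'I_N -> 'rV[R]_n) (h : 'I_N -> R),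
    [/\ forall i, enorm (u i) = 1, L `<=` polytope u h &
      polytope u h `<=` outer_parallel L k].
Proof.
move=> L0 cL vL k0.
have [r r0 Lr] := compact_enorm_bounded cL.
(* [e <= 1/2] keeps the inner product of [u] and [v] at least [1/2]. The test against [v] then
   yields [d / 2 <= 2 r e], whence [d <= 4 r e <= k]. The summand 1 in [r + 1] prevents a zero
   denominator. *)
pose e := Num.min (2^-1) (k / (4 * (r + 1))).
have e0 : 0 < e by rewrite lt_min invr_gt0 ltr0n divr_gt0// mulr_gt0//; lra.
have e2 : e <= 2^-1 by rewrite ge_min lexx.
have ek : 4 * r * e <= k.
  apply: (@le_trans _ _ (4 * (r + 1) * e)).
    by rewrite ler_wpM2r ?(ltW e0)//; lra.
  by rewrite -ler_pdivlMl ?mulr_gt0//; [rewrite mulrC ge_min lexx orbT|lra].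
have [s [s1 sc]] := unit_sphere_net e0.
have hsup u : exists q, L q /\ forall y, L y -> dotp y u <= dotp q u.
  have [] := @EVT_max_rV R n (fun y => dotp y u) L L0 cL.
    exact/continuous_subspaceT/continuous_dotp.
  by move=> q; rewrite inE => Lq qmax; exists q; split => // y Ly; apply: qmax; rewrite inE.
pose q u := projT1 (cid (hsup u)).
have Lq u : L (q u) by rewrite /q; case: cid => ? [? ?].
have qmax u y : L y -> dotp y u <= dotp (q u) u
  by rewrite /q; move=> Ly; case: cid => ? [? H]; exact: H.
pose w (i : 'I_(size s)) := nth 0 s i.
exists (size s), w, (fun i => dotp (q (w i)) (w i)); split=> [i|x Lx i|x xP].
- by apply: s1; exact: mem_nth.
- exact: qmax.
apply/outer_parallelP; first exact: ltW.
have [Lx|Lx] := pselect (L x); first by exists x => //; rewrite subrr enorm0 ltW.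
have [p [u [d [Lp u1 d0 xE pu]]]] := separation L0 cL vL Lx.
exists p => //.
have [v vs uv] := sc u u1.
have xv : dotp x v <= dotp (q v) v.
  by move: vs => /(nthP 0)[i si <-]; exact: (xP (Ordinal si)).
rewrite xE addrC addKr enormZ u1 mulr1 gtr0_norm//.
have uu : dotp u u = 1 by rewrite -sqr_enorm u1 expr1n.
have h1 := pu _ (Lq v).
have h2 : dotp (q v - p) (v - u) <= (r + r) * e.
  apply: le_trans (dotp_le _ _) _; apply: ler_pM; rewrite ?enorm_ge0//.
    by apply: le_trans (enormD _ _) _; rewrite enormN lerD// Lr.
  by rewrite -enormN opprB.
have h3 : dotp u (u - v) <= e by apply: le_trans (dotp_le _ _) _; rewrite u1 mul1r.
move: xv h2 h3; rewrite xE !dotpBr !dotpBl dotpDl dotpZl uu => xv h2 h3.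
have h4 : d * (1 - dotp u v) <= d * e by rewrite ler_wpM2l// ltW.
have h5 : d * e <= d / 2 by rewrite ler_wpM2l// ltW.
lra.
Qed.
End polytope_approximation.

(** * Volume in row-vector space *)

Section row_vector_volume.
Context {R : realType} {n : nat}.
Notation RT := (measurableTypeR R).
Implicit Types (x y z u v : 'rV[R]_n) (A B K L : set 'rV[R]_n).

Definition tuple_set A : set (n.-tuple RT) := [set t | A (\row_i tnth t i)].

Definition measurable_rV A := measurable (tuple_set A).

Definition mvol A : \bar R := lebesgue_tuple (tuple_set A).

Definition rational_box (p : n.-tuple rat * nat) : set 'rV[R]_n :=
  [set x | forall i, `|x 0 i - ratr (tnth p.1 i)| < p.2.+1%:R^-1].

Lemma measurable_rational_box p : measurable_rV (rational_box p).
Proof.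
rewrite /measurable_rV (_ : tuple_set _ = \bigcap_(i in [set: 'I_n])
  ((@tnth n RT)^~ i @^-1` ball (ratr (tnth p.1 i) : R) p.2.+1%:R^-1)).
  apply: fin_bigcap_measurable; first exact: finite_finset.
  move=> i _; apply: preimage_measurable; last exact: measurable_ball.
  exact: measurable_tnth.
apply/seteqP; split=> t /= tc i.
  by move=> _; have := tc i; rewrite mxE -ball_normE/= distrC.
by have := tc i Logic.I; rewrite mxE -ball_normE/= distrC.
Qed.

(** The sigma-algebra on tuples comes from the coordinates, so an open set has to be exhibited as a
    countable union of boxes with rational centres. *)
Lemma open_measurable_rV A : open A -> measurable_rV A.
Proof.
move=> oA; rewrite /measurable_rV.
(* A box that leaves [A] contributes the empty set, so the union can run over all indices. *)
pose F (p : n.-tuple rat * nat) : set (n.-tuple RT) :=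
  [set t | rational_box p `<=` A /\ tuple_set (rational_box p) t].
rewrite (_ : tuple_set A = \bigcup_p F p).
  apply: countable_bigcupT_measurable => // p.
  have [pA|pA] := pselect (rational_box p `<=` A).
    rewrite (_ : F p = tuple_set (rational_box p)); first exact: measurable_rational_box.
    by apply/seteqP; split=> t // [].
  by rewrite (_ : F p = set0)//; apply/seteqP; split=> t // [].
apply/seteqP; split=> [t At|t [p _ [pA pt]]]; last exact: pA.
pose x : 'rV[R]_n := \row_i tnth t i.
have /nbhs_ballP[e e0 eA] : nbhs x A by move: oA; rewrite openE; exact.
(* The half-side is below [e / 2] because both [x] and [y] are compared with the rational centre. *)
have [k ke] : exists k, k.+1%:R^-1 < e / 2.
  exists (Num.truncn (e / 2)^-1).
  by rewrite invf_plt ?posrE ?divr_gt0// truncnS_gt.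
have r0 : 0 < k.+1%:R^-1 :> R by rewrite invr_gt0.
have ex i : exists q : rat, `|x 0 i - ratr q| < k.+1%:R^-1.
  have /rat_in_itvoo[q] : x 0 i - k.+1%:R^-1 < x 0 i + k.+1%:R^-1.
    by rewrite ltrBlDr -addrA ltrDl addr_gt0.
  rewrite in_itv/= => /andP[h1 h2]; exists q.
  by rewrite ltr_norml ltrBrDl -ltrBrDr opprK h2/= ltrBlDr -ltrBlDl.
pose q := [tuple projT1 (cid (ex i)) | i < n].
have xq i : `|x 0 i - ratr (tnth q i)| < k.+1%:R^-1.
  by rewrite tnth_mktuple; case: cid.
exists (q, k) => //; split; last exact: xq.
move=> y yq; apply: eA; split => // i j; rewrite ord1 -ball_normE/=.
rewrite -(subrKA (ratr (tnth q j))); apply: le_lt_trans (ler_normD _ _) _.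
have := yq j; rewrite /= distrC => yj.
by apply: lt_trans (ltrD (xq j) yj) _; rewrite [ltRHS]splitr ltrD.
Qed.

Lemma closed_measurable_rV A : closed A -> measurable_rV A.
Proof.
move=> /closed_openC/open_measurable_rV mA; rewrite /measurable_rV.
by rewrite -(setCK (tuple_set A)); exact: measurableC.
Qed.

Lemma compact_measurable_rV A : compact A -> measurable_rV A.
Proof.
move=> cA; apply: closed_measurable_rV.
by apply: compact_closed cA; exact: norm_hausdorff.
Qed.

Lemma tuple_set_cube A (c : R) : A `<=` coord_cube c -> tuple_set A `<=` @tuple_cube R n c.
Proof. by move=> Ac t /Ac tc i; have := tc i; rewrite mxE. Qed.

Lemma compact_mvol_fin A : compact A -> mvol A \is a fin_num.
Proof.
move=> cA; have [c c0 Ac] := compact_sub_coord_cube cA.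
exact: (fin_num_sub_cube (compact_measurable_rV cA) c0 (tuple_set_cube Ac)).
Qed.

Lemma volE A : compact A -> (vol A)%:E = mvol A.
Proof. by move=> cA; rewrite fineK// compact_mvol_fin. Qed.

Lemma vol_ge0 A : 0 <= vol A.
Proof. exact: fine_ge0. Qed.

Lemma le_vol A B : compact A -> compact B -> A `<=` B -> vol A <= vol B.
Proof.
move=> cA cB AB; rewrite -lee_fin !volE//.
apply: le_measure; rewrite ?inE; try exact: compact_measurable_rV.
by move=> t /AB.
Qed.

Lemma mvol_affine A (a : 'rV[R]_n) (r : R) : 0 < r -> measurable_rV A ->
  mvol [set x | A (a + r *: x)] = ((r ^- n)%:E * mvol A)%E.
Proof.
move=> r0 mA; rewrite -(lebesgue_tuple_affine [tuple a 0 i | i < n] r0 mA).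
congr lebesgue_tuple; apply/seteqP; split=> t /=; rewrite /tuple_set/=;
  congr A; apply/rowP => i; by rewrite !mxE !tnth_mktuple.
Qed.

Lemma measurable_affine A (a : 'rV[R]_n) (r : R) : measurable_rV A ->
  measurable_rV [set x | A (a + r *: x)].
Proof.
move=> mA; have := preimage_measurable (measurable_affine_tuple [tuple a 0 i | i < n] r) mA.
congr measurable; apply/seteqP; split=> t /=; rewrite /tuple_set/=;
  congr A; apply/rowP => i; by rewrite !mxE !tnth_mktuple.
Qed.

Lemma vol_affine A (a : 'rV[R]_n) (r : R) : 0 < r -> compact A ->
  vol [set x | A (a + r *: x)] = r ^- n * vol A.
Proof.
move=> r0 cA; have mA := compact_measurable_rV cA.
by rewrite -[LHS]/(fine (mvol _)) mvol_affine// fineM// compact_mvol_fin.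
Qed.
End row_vector_volume.

(** * Additive Brunn-Minkowski and the shell of a polytope *)

Section volume_inequalities.
Context {R : realType} {n : nat}.
Notation RT := (measurableTypeR R).
Implicit Types (x y z u v : 'rV[R]_n) (A B C K L : set 'rV[R]_n).

Lemma compact_affine A (a : 'rV[R]_n) (r : R) : 0 < r -> compact A ->
  compact [set x | A (a + r *: x)].
Proof.
move=> r0 cA.
rewrite (_ : [set x | _] = (fun x => r^-1 *: (x - a)) @` A); last first.
  apply/seteqP; split=> [x Ax|_ [x Ax <-]] /=.
    exists (a + r *: x) => //.
    by rewrite addrC addKr scalerA mulVf ?gt_eqF// scale1r.
  by rewrite scalerA mulfV ?gt_eqF// scale1r addrCA subrr addr0.
apply: continuous_compact cA; apply: continuous_subspaceT => x.
apply: (continuous_comp (f := fun y : 'rV[R]_n => y - a)).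
  by apply: continuousB => //; exact: cst_continuous.
exact: scaler_continuous.
Qed.

Lemma vol_brunn_minkowski_mul (s : R) A B C : 0 < s < 1 ->
  compact A -> compact B -> compact C ->
  (forall x y, A x -> B y -> C ((1 - s) *: x + s *: y)) ->
  vol A `^ (1 - s) * vol B `^ s <= vol C.
Proof.
move=> s01 cA cB cC ABC.
have [a a0 Aa] := compact_sub_coord_cube cA.
have [b b0 Bb] := compact_sub_coord_cube cB.
have [c c0 Cc] := compact_sub_coord_cube cC.
have cubeS (k l : R) : k <= l -> @coord_cube R n k `<=` coord_cube l.
  by move=> kl x xk i; exact: le_trans (xk i) kl.
apply: (@brunn_minkowski_mul R n s (a + b + c)) => //.
- by rewrite !addr_ge0.
- exact: compact_measurable_rV.
- exact: compact_measurable_rV.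
- exact: compact_measurable_rV.
- by apply: tuple_set_cube => x /Aa; apply: cubeS; rewrite -addrA lerDl addr_ge0.
- by apply: tuple_set_cube => x /Bb; apply: cubeS; rewrite addrAC lerDr addr_ge0.
- by apply: tuple_set_cube => x /Cc; apply: cubeS; rewrite lerDr addr_ge0.
move=> t u At Bu; rewrite /tuple_set/=.
rewrite (_ : \row_i _ = (1 - s) *: (\row_i tnth t i) + s *: (\row_i tnth u i)).
  exact: ABC.
by apply/rowP => i; rewrite !mxE tnth_mktuple.
Qed.

(** The function f of the overview; it is proportional to the radius of the ball with the same
    volume. *)
Definition mean_radius A : R := vol A `^ n%:R^-1.

Lemma mean_radius_ge0 A : 0 <= mean_radius A.
Proof. exact: powR_ge0. Qed.

Lemma mean_radius_gt0 A : 0 < vol A -> 0 < mean_radius A.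
Proof. exact: powR_gt0. Qed.

Lemma mean_radiusX A : (0 < n)%N -> mean_radius A ^+ n = vol A.
Proof.
move=> n0; rewrite -powR_mulrn ?mean_radius_ge0// -powRrM.
by rewrite mulVf ?powRr1 ?vol_ge0// pnatr_eq0 -lt0n.
Qed.

Lemma le_mean_radius A B : vol A <= vol B -> mean_radius A <= mean_radius B.
Proof. by move=> AB; rewrite ge0_ler_powR// ?nnegrE ?vol_ge0// invr_ge0. Qed.

(* Rescaling A and B to volume 1 turns the multiplicative inequality into the additive one. *)
Lemma vol_brunn_minkowski (s : R) A B C : (0 < n)%N -> 0 < s < 1 ->
  compact A -> compact B -> compact C -> 0 < vol A -> 0 < vol B ->
  (forall x y, A x -> B y -> C ((1 - s) *: x + s *: y)) ->
  (1 - s) * mean_radius A + s * mean_radius B <= mean_radius C.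
Proof.
move=> n0 /andP[s0 s1] cA cB cC vA vB ABC.
have := mean_radiusX A n0; have := mean_radiusX B n0.
have := mean_radius_gt0 vA; have := mean_radius_gt0 vB.
set a := mean_radius A; set b := mean_radius B => b0 a0 bE aE.
pose m := (1 - s) * a + s * b.
have s1' : 0 < 1 - s by rewrite subr_gt0.
have m0 : 0 < m by rewrite addr_gt0// mulr_gt0.
(* The weight for which [m ((1 - t) x + t y) = (1 - s) (a x) + s (b y)]. *)
pose t := s * b / m.
have t01 : 0 < t < 1.
  by rewrite divr_gt0 ?mulr_gt0//= ltr_pdivrMr// mul1r ltrDr mulr_gt0.
have := @vol_brunn_minkowski_mul t [set x | A (0 + a *: x)] [set x | B (0 + b *: x)]
  [set x | C (0 + m *: x)] t01 (compact_affine a0 cA) (compact_affine b0 cB)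
  (compact_affine m0 cC).
rewrite !vol_affine// -aE -bE !mulVf ?gt_eqF ?exprn_gt0// !powR1 mulr1 => H.
have {}H : 1 <= m ^- n * vol C.
  apply: H => x y /=; rewrite !add0r => Ax By.
  rewrite (_ : m *: _ = (1 - s) *: (a *: x) + s *: (b *: y)); first exact: ABC.
  rewrite scalerDr !scalerA; congr (_ *: _ + _ *: _); rewrite /t; last first.
    by rewrite mulrCA mulfV ?gt_eqF// mulr1.
  by rewrite mulrBr mulr1 mulrCA mulfV ?gt_eqF// mulr1 /m addrK.
have {}H : m ^+ n <= vol C by rewrite ler_pdivlMl ?exprn_gt0// mulr1 in H.
by rewrite -(@ler_pXn2r _ n)// ?nnegrE ?mean_radius_ge0 ?(ltW m0)// mean_radiusX.
Qed.

Lemma closed_halfspace u (c : R) : closed [set x | dotp x u <= c].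
Proof.
by have /continuous_closedP := @continuous_dotp R n u => /(_ _ (@closed_le R c)).
Qed.

Lemma open_halfspace u (c : R) : open [set x | dotp x u < c].
Proof.
by have /continuousP := @continuous_dotp R n u => /(_ _ (@open_lt R c)).
Qed.

Lemma closed_polytope N (u : 'I_N -> 'rV[R]_n) (h : 'I_N -> R) : closed (polytope u h).
Proof.
rewrite (_ : polytope u h = \bigcap_(i in [set: 'I_N]) [set x | dotp x (u i) <= h i]).
  by apply: closed_bigI => i _; exact: closed_halfspace.
by apply/seteqP; split=> x /= xP i; [move=> _|]; apply: xP.
Qed.

(* The shell between the facets and their inward translates by d is cut into
   pieces according to the (first) nearest facet; translating the i-th piece by
   [d *: u i] pushes the pieces out of the polytope while keeping them disjoint,
   because i is then the first index of the most violated inequality. *)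
Lemma polytope_shell N (u : 'I_N -> 'rV[R]_n) (h : 'I_N -> R) (d : R) Q :
  (forall i, enorm (u i) = 1) -> 0 < d -> compact (polytope u h) -> compact Q ->
  polytope u h `<=` Q -> (forall x i, polytope u h x -> Q (x + d *: u i)) ->
  2 * vol (polytope u h) <= vol (polytope u (fun i => h i - d)) + vol Q.
Proof.
move=> u1 d0 cP cQ PQ PdQ.
set P := polytope u h in cP PQ PdQ *; set P' := polytope u _.
have cP' : compact P'.
  apply: (@subclosed_compact _ _ P) => //; first exact: closed_polytope.
  by move=> x xP' i; apply: le_trans (xP' i) _; rewrite gerBl ltW.
pose slack i x := h i - dotp x (u i).
(* The strict inequality for smaller indices breaks ties, so that the pieces are disjoint. *)
pose I i : set 'rV[R]_n := [set x | [/\ P x, slack i x < d &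
  forall j : 'I_N, if (j < i)%N then slack i x < slack j x else slack i x <= slack j x]].
pose J i : set 'rV[R]_n := [set y | I i (- (d *: u i) + 1 *: y)].
have mI i : measurable_rV (I i).
  pose H (j : 'I_N) : set 'rV[R]_n := if (j < i)%N then [set x | dotp x (u j - u i) < h j - h i]
    else [set x | dotp x (u j - u i) <= h j - h i].
  have mH j : measurable_rV (H j).
    rewrite /H; case: ifP => _; first by apply: open_measurable_rV; exact: open_halfspace.
    by apply: closed_measurable_rV; exact: closed_halfspace.
  rewrite /measurable_rV (_ : tuple_set _ = tuple_set P `&`
      ~` tuple_set [set x | dotp x (u i) <= h i - d] `&`
      \bigcap_(j in [set: 'I_N]) tuple_set (H j)).
    apply: measurableI; last first.
      by apply: fin_bigcap_measurable => [|j _]; [exact: finite_finset|exact: mH].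
    apply: measurableI; first exact: compact_measurable_rV.
    by apply: measurableC; apply: closed_measurable_rV; exact: closed_halfspace.
  have HE (j : 'I_N) x : H j x <->
      if (j < i)%N then slack i x < slack j x else slack i x <= slack j x.
    by rewrite /H /slack; case: ifP => _ /=; rewrite dotpBr; split; lra.
  apply/seteqP; split=> t; rewrite /tuple_set /I/= /slack.
    move=> [Pt td tj]; split; first by split => //; apply/negP; rewrite -ltNge; lra.
    by move=> j _; apply/HE; exact: tj.
  move=> [[Pt /negP td] tj]; split => //; first by rewrite -ltNge in td; lra.
  by move=> j; apply/HE; exact: tj.
have mJ i : measurable_rV (J i) by exact: measurable_affine.
have IJ i : mvol (J i) = mvol (I i).
  by rewrite mvol_affine// expr1n invr1 mul1e.
(* After translation by [d u_i], constraint [j] is exceeded by [d <u_i, u_j> - slack_j]. Since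
   [<u_i, u_j> <= 1], with equality for [j = i], the order of the slacks is kept and [i] can be
   recovered from [y]. *)
have violation i y : J i y -> [/\ dotp y (u i) > h i,
    forall j : 'I_N, (j < i)%N -> dotp y (u j) - h j < dotp y (u i) - h i &
    forall j, dotp y (u j) - h j <= dotp y (u i) - h i].
  rewrite /J/= scale1r addrC => -[Py yd yj].
  have uu j : dotp (u j) (u j) = 1 by rewrite -sqr_enorm u1 expr1n.
  have uij j : d * dotp (u i) (u j) <= d.
    by rewrite ler_piMr ?(ltW d0)//; apply: le_trans (dotp_le _ _) _; rewrite !u1 mulr1.
  move: yd; rewrite /slack dotpBl dotpZl uu mulr1 => yd.
  split=> [|j ji|j]; first lra.
    by have := yj j; rewrite ji /slack !dotpBl !dotpZl uu; have := uij j; lra.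
  by have := yj j; case: ifP => _; rewrite /slack !dotpBl !dotpZl uu; have := uij j; lra.
have JQ i : J i `<=` Q.
  move=> y; rewrite /J/= scale1r => -[Py _ _].
  by have := PdQ _ i Py; rewrite addrC addNKr.
have tI : trivIset setT (fun i => tuple_set (I i)).
  apply/trivIsetP => i j _ _; wlog ij : i j / (i < j)%N.
    move=> wl nij; have [ij|ji|/val_inj ij] := ltngtP i j.
    - exact: wl.
    - by rewrite setIC; apply: wl => //; rewrite eq_sym.
    - by rewrite ij eqxx in nij.
  move=> _; apply/seteqP; split=> // t [[_ _ /(_ j)]]; rewrite ltnNge (ltnW ij)/=.
  by move=> h1 [_ _ /(_ i)]; rewrite ij ltNge h1.
have tJ : trivIset setT (fun i => tuple_set (J i)).
  apply/trivIsetP => i j _ _; wlog ij : i j / (i < j)%N.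
    move=> wl nij; have [ij|ji|/val_inj ij] := ltngtP i j.
    - exact: wl.
    - by rewrite setIC; apply: wl => //; rewrite eq_sym.
    - by rewrite ij eqxx in nij.
  move=> _; apply/seteqP; split=> // t [/violation[_ _ /(_ j) h1] /violation[_ /(_ _ ij) h2 _]].
  by move: h2; rewrite ltNge h1.
have UE (F : 'I_N -> set (n.-tuple RT)) : \big[setU/set0]_(i < N) F i = \bigcup_i F i.
  rewrite -bigcup_seq; congr (\bigcup_(t in mkset _) _).
  by apply/funext => i; rewrite mem_index_enum; apply/propext.
pose UI := \big[setU/set0]_(i < N) tuple_set (I i).
pose UJ := \big[setU/set0]_(i < N) tuple_set (J i).
have mUI : measurable UI by apply: bigsetU_measurable => i _; exact: mI.
have mUJ : measurable UJ by apply: bigsetU_measurable => i _; exact: mJ.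
have UIJ : lebesgue_tuple UI = lebesgue_tuple UJ.
  by rewrite !measure_bigsetU_ord//; apply: eq_bigr => i _; exact/esym/IJ.
have mP := compact_measurable_rV cP; have mP' := compact_measurable_rV cP'.
have mQ := compact_measurable_rV cQ.
have PI : (mvol P <= mvol P' + lebesgue_tuple UI)%E.
  apply: le_trans (measureU2 _ _ _) => //.
  apply: le_measure; rewrite ?inE//; first exact: measurableU.
  move=> t Pt; have [P't|P't] := pselect (tuple_set P' t); [by left|right].
  pose x : 'rV[R]_n := \row_i tnth t i.
  have [i0 xi0] : exists i, slack i x < d.
    apply: contrapT => /forallNP nx; apply: P't => i.
    by have /negP := nx i; rewrite -leNgt /slack; lra.
  (* Two nested minima: first the least slack, then the least index attaining it. *)
  pose i1 := [arg min_(i < i0) slack i x]%O.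
  have i1P j : slack i1 x <= slack j x.
    by rewrite /i1; case: arg_minP => // i _; apply.
  pose i := [arg min_(i < i1 | slack i x == slack i1 x) (i : nat)].
  have [ii1 iP] : slack i x = slack i1 x /\
      forall j, slack j x == slack i1 x -> (i <= j)%N.
    by rewrite /i; case: arg_minnP => // k /eqP.
  rewrite /UI UE; exists i => //; split => //; first by rewrite ii1 (le_lt_trans (i1P i0)).
  move=> j; case: ifP => ji; rewrite ii1; last exact: i1P.
  rewrite lt_neqAle i1P andbT; apply: contraTN ji => /eqP ij.
  by rewrite -leqNgt; apply: iP; rewrite ij.
have QJ : (mvol P + lebesgue_tuple UJ <= mvol Q)%E.
  rewrite -measureU//.
    apply: le_measure; rewrite ?inE//; first exact: measurableU.
    by move=> t [/PQ//|]; rewrite /UJ UE => -[i _ /JQ].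
  apply/seteqP; split=> // t [Pt]; rewrite /UJ UE => -[i _ /violation[hi _ _]].
  by have := Pt i; rewrite leNgt hi.
rewrite -lee_fin mulr_natl mulr2n !EFinD !volE//.
rewrite -UIJ in QJ; apply: le_trans (leeD (lexx _) PI) _.
by rewrite addeCA; apply: leeD.
Qed.
End volume_inequalities.

(** * Parallel bodies *)

Section parallel_volumes.
Context {R : realType} {n : nat}.
Implicit Types (x y z u v : 'rV[R]_n) (A B C K L M : set 'rV[R]_n).

Lemma compact_closed_rV A : compact A -> closed A.
Proof. by move=> cA; apply: compact_closed cA; exact: norm_hausdorff. Qed.

Lemma compact_outer_parallel L (e : R) : 0 <= e -> compact L -> compact (outer_parallel L e).
Proof.
move=> e0 cL; rewrite /outer_parallel dilate_unit_ball//.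
rewrite (_ : minkowski_sum _ _ =
    (fun p : 'rV[R]_n * 'rV[R]_n => p.1 + p.2) @` (L `*` [set x | enorm x <= e])).
  apply: continuous_compact; last by apply: compact_setX => //; exact: compact_enorm_le.
  by apply: continuous_subspaceT => p; exact: add_continuous.
apply/seteqP; split=> [_ [x Lx [b be <-]]|_ [[x b] [/= Lx be] <-]]; first by exists (x, b).
by exists x => //; exists b.
Qed.

Lemma inner_parallel_sub K (l : R) : inner_parallel K l `<=` K.
Proof. by move=> x /inner_parallelP/(_ 0); rewrite enorm0 addr0; exact. Qed.

Lemma compact_inner_parallel K (l : R) : compact K -> compact (inner_parallel K l).
Proof.
move=> cK; apply: (@subclosed_compact _ _ K) => //; last exact: inner_parallel_sub.
rewrite (_ : inner_parallel K l =
    \bigcap_(b in [set b : 'rV[R]_n | enorm b <= `|l|]) [set x | K (b + 1 *: x)]).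
  apply: closed_bigI => b _; apply: compact_closed_rV.
  exact: compact_affine.
apply/seteqP; split=> x.
  by move=> /inner_parallelP Kx b bl /=; rewrite scale1r addrC; exact: Kx.
by move=> Kx; apply/inner_parallelP => b bl; have := Kx b bl; rewrite /= scale1r addrC.
Qed.

Lemma sub_outer_parallel L (e : R) : 0 <= e -> L `<=` outer_parallel L e.
Proof.
by move=> e0 x Lx; apply/outer_parallelP => //; exists x => //; rewrite subrr enorm0.
Qed.

(** The polytope is taken within [k = (1 - c) d] of [L]. Its outward translates stay within
    [k + d = (2 - c) d] of [L], and by cancellation the polytope shrunk by [d] lies in the inner
    parallel body at [d - k = c d]. *)
Lemma vol_shell L (c d : R) : L !=set0 -> compact L -> convex_in L ->
  0 < c < 1 -> 0 < d ->
  2 * vol L <= vol (inner_parallel L (c * d)) + vol (outer_parallel L ((2 - c) * d)).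
Proof.
move=> L0 cL vL /andP[c0 c1] d0.
pose k := (1 - c) * d.
have k0 : 0 < k by rewrite mulr_gt0// subr_gt0.
have [N [u [h [u1 LP PL]]]] := circumscribed_polytope L0 cL vL k0.
have cP : compact (polytope u h).
  apply: (@subclosed_compact _ _ (outer_parallel L k)) => //; first exact: closed_polytope.
  exact: compact_outer_parallel (ltW k0) cL.
have e0 : 0 <= (2 - c) * d by rewrite mulr_ge0 ?(ltW d0)//; lra.
have eE : (2 - c) * d = k + d by rewrite /k; ring.
have cQ := compact_outer_parallel e0 cL.
have cI := compact_inner_parallel (l := c * d) cL.
have PQ : polytope u h `<=` outer_parallel L ((2 - c) * d).
  move=> x /PL /(outer_parallelP _ _ (ltW k0))[y Ly xy]; apply/outer_parallelP => //.
  by exists y => //; rewrite eE (le_trans xy)// lerDl ltW.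
have PdQ x i : polytope u h x -> outer_parallel L ((2 - c) * d) (x + d *: u i).
  move=> /PL /(outer_parallelP _ _ (ltW k0))[y Ly xy]; apply/outer_parallelP => //.
  exists y => //; rewrite addrAC (le_trans (enormD _ _))// eE lerD//.
  by rewrite enormZ u1 mulr1 gtr0_norm.
have vLP := le_vol cL cP LP.
have P'I : polytope u (fun i => h i - d) `<=` inner_parallel L (c * d).
  move=> x Px; apply/inner_parallelP => b; rewrite gtr0_norm ?mulr_gt0// => bcd.
  apply: (outer_parallel_cancel L0 cL vL (ltW k0) (d := d)).
    move=> b' b'd; have /PL/(outer_parallelP _ _ (ltW k0)) : polytope u h (x + b').
      move=> i; rewrite dotpDl.
      have := Px i; have := dotp_le b' (u i); rewrite u1 mulr1; lra.
    by [].
  by rewrite (le_trans bcd)// le_eqVlt; apply/orP; left; apply/eqP; rewrite /k; ring.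
have cP' : compact (polytope u (fun i => h i - d)).
  apply: (@subclosed_compact _ _ (inner_parallel L (c * d))) => //.
  exact: closed_polytope.
have := polytope_shell u1 d0 cP cQ PQ PdQ.
have := le_vol cP' cI P'I.
lra.
Qed.

Lemma vol_gt0 A x (r : R) : 0 < r -> compact A ->
  (forall b, enorm b <= r -> A (x + b)) -> 0 < vol A.
Proof.
move=> r0 cA Ab.
(* A cube of half-side [c] lies in the ball of radius [r] because [n c^2 <= r^2]; the successor
   keeps the denominator positive. *)
pose c := r / n.+1%:R.
have c0 : 0 < c by rewrite divr_gt0.
have cC : compact [set y : 'rV[R]_n | coord_cube c (- x + 1 *: y)].
  by apply: compact_affine => //; exact: compact_coord_cube.
have volC : vol (@coord_cube R n c) = (2 * c) ^+ n.
  rewrite /vol [X in lebesgue_tuple X](_ : _ = @tuple_cube R n c).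
    by rewrite lebesgue_tuple_cube// ltW.
  by apply/seteqP; split=> t tc i; have := tc i; rewrite mxE.
apply: (@lt_le_trans _ _ (vol [set y : 'rV[R]_n | coord_cube c (- x + 1 *: y)])).
  rewrite vol_affine//; last exact: compact_coord_cube.
  by rewrite expr1n invr1 mul1r volC exprn_gt0// mulr_gt0.
apply: le_vol => // y /=; rewrite scale1r addrC => yc.
rewrite -(subrK x y) addrC; apply: Ab.
rewrite -(@ler_pXn2r _ 2)// ?nnegrE ?enorm_ge0 ?(ltW r0)// sqr_enorm /dotp.
apply: (@le_trans _ _ (\sum_(i < n) c ^+ 2)).
  apply: ler_sum => i _; rewrite -expr2 -real_normK ?num_real//.
  by rewrite ler_pXn2r ?nnegrE ?(ltW c0)//; exact: yc.
rewrite sumr_const card_ord -mulr_natl /c expr_div_n mulrCA ger_pMr ?exprn_gt0//.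
rewrite ler_pdivrMr ?exprn_gt0// mul1r expr2 -natrM ler_nat.
by rewrite (leq_trans (leqnSn n))// leq_pmulr.
Qed.

Lemma convex_in_inner_parallel K (l : R) : convex_in K -> convex_in (inner_parallel K l).
Proof.
move=> vK x y s /inner_parallelP Kx /inner_parallelP Ky s01; apply/inner_parallelP => b bl.
rewrite (_ : _ + b = (1 - s) *: (x + b) + s *: (y + b)).
  by apply: vK => //; [exact: Kx|exact: Ky].
by rewrite !scalerDr addrACA -scalerDl subrK scale1r.
Qed.

(** This is the concavity of the inner family: a vector [w] of length at most [(1 - s) |a| + s |b|]
    splits into collinear shares that the balls around [x] and [y] can absorb. *)
Lemma inner_parallel_conv K (s a b : R) x y : convex_in K -> 0 <= s <= 1 ->
  a <= 0 -> b <= 0 -> inner_parallel K a x -> inner_parallel K b y ->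
  inner_parallel K ((1 - s) * a + s * b) ((1 - s) *: x + s *: y).
Proof.
move=> vK /[dup] s01 /andP[s0 s1] a0 b0 /inner_parallelP Kx /inner_parallelP Ky.
apply/inner_parallelP => w.
have s1' : 0 <= 1 - s by rewrite subr_ge0.
have mid0 : (1 - s) * a + s * b <= 0.
  by rewrite -oppr_ge0 opprD -!mulrN addr_ge0// mulr_ge0// oppr_ge0.
rewrite ler0_norm//; set m := - _ => wm.
have mE : m = (1 - s) * - a + s * - b by rewrite /m; ring.
have [m0|mn0] := eqVneq m 0.
  have -> : w = 0 by apply: enorm_eq0; apply/eqP; rewrite eq_le enorm_ge0 -m0 wm.
  rewrite addr0; apply: vK => //.
    by have := Kx 0; rewrite enorm0 addr0; exact.
  by have := Ky 0; rewrite enorm0 addr0; exact.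
have {mn0}m0 : 0 < m by rewrite lt_neqAle eq_sym mn0 (le_trans _ wm) ?enorm_ge0.
pose p := - a / m; pose q := - b / m.
have pq : (1 - s) * p + s * q = 1.
  by rewrite /p /q !mulrA -mulrDl -mE mulfV ?gt_eqF.
have bd (c : R) : c <= 0 -> enorm ((- c / m) *: w) <= `|c|.
  move=> c0; rewrite enormZ normrM normrN (ger0_norm (x := m^-1)) ?invr_ge0 ?(ltW m0)//.
  by rewrite -mulrA ler_piMr// ler_pdivrMl// mulr1.
rewrite (_ : _ + w = (1 - s) *: (x + p *: w) + s *: (y + q *: w)).
  by apply: vK => //; [apply: Kx|apply: Ky]; exact: bd.
by rewrite !scalerDr addrACA !scalerA -scalerDl pq scale1r.
Qed.

Lemma outer_parallel_conv L (s e : R) x y : convex_in L -> 0 <= s <= 1 -> 0 <= e ->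
  L x -> outer_parallel L e y -> outer_parallel L (s * e) ((1 - s) *: x + s *: y).
Proof.
move=> vL /[dup] s01 /andP[s0 s1] e0 Lx /(outer_parallelP _ _ e0)[z Lz yz].
apply/outer_parallelP; first by rewrite mulr_ge0.
exists ((1 - s) *: x + s *: z); first exact: vL.
rewrite opprD addrACA subrr add0r -scalerBr enormZ ger0_norm//.
by rewrite ler_wpM2l.
Qed.

(** Concavity across the junction of the inner and outer families. Write [y] as [z] in [M] plus a
    vector of length at most [e]; its share [s (y - z)] is moved onto [x], where it is scaled by
    [t / e] since [(1 - s) (t / e) = s], and the room [t] around [L] absorbs it. *)
Lemma inner_outer_conv L M (t e : R) x y : convex_in M -> 0 < t -> 0 < e ->
  (forall x b, L x -> enorm b <= t -> M (x + b)) ->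
  L x -> outer_parallel M e y ->
  M ((1 - t / (t + e)) *: x + (t / (t + e)) *: y).
Proof.
move=> vM t0 e0 LM Lx /(outer_parallelP _ _ (ltW e0))[z Mz yz].
have te0 : 0 < t + e by rewrite addr_gt0.
set s := t / (t + e).
rewrite (_ : _ + _ = (1 - s) *: (x + (t / e) *: (y - z)) + s *: z).
  apply: vM => //; last by rewrite divr_ge0 ?(ltW t0) ?(ltW te0)//= ler_pdivrMr// mul1r lerDl ltW.
  apply: LM => //; rewrite enormZ ger0_norm ?divr_ge0 ?(ltW t0) ?(ltW e0)//.
  by rewrite mulrAC ler_pdivrMr// ler_pM2l.
rewrite scalerDr -addrA scalerA (_ : (1 - s) * (t / e) = s).
  by rewrite scalerBr subrK.
by rewrite /s; field; rewrite !gt_eqF.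
Qed.
End parallel_volumes.

(** * Surface area and the isoperimetric quotient *)

Section slopes.
Context {R : realType}.

Lemma expr_secant_ge (n : nat) (a v : R) : 0 <= v <= a ->
  v * (n%:R * (a - v) ^+ n.-1) <= a ^+ n - (a - v) ^+ n.
Proof.
move=> /andP[v0 va]; rewrite subrXX opprB addrCA subrr addr0 ler_wpM2l//.
rewrite mulr_natl -[X in _ *+ X]card_ord -sumr_const; apply: ler_sum => i _.
have iE : n.-1 = (n.-1 - i + i)%N by rewrite subnK// -ltnS prednK// (leq_ltn_trans _ (ltn_ord i)).
rewrite {1}iE exprD ler_wpM2r ?exprn_ge0 ?subr_ge0//.
by rewrite lerXn2r ?nnegrE ?subr_ge0 ?(le_trans v0)// gerBl.
Qed.

Lemma expr_secant_le (n : nat) (a w : R) : 0 <= a -> 0 <= w ->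
  (a + w) ^+ n - a ^+ n <= w * (n%:R * (a + w) ^+ n.-1).
Proof.
move=> a0 w0; rewrite subrXX addrAC subrr add0r ler_wpM2l//.
rewrite mulr_natl -[X in _ <= _ *+ X]card_ord -sumr_const; apply: ler_sum => i _.
have iE : n.-1 = (n.-1 - i + i)%N by rewrite subnK// -ltnS prednK// (leq_ltn_trans _ (ltn_ord i)).
rewrite {2}iE exprD ler_wpM2l ?exprn_ge0 ?addr_ge0//.
by rewrite lerXn2r ?nnegrE ?addr_ge0// lerDl.
Qed.

Lemma cvg_expr (T : Type) (F : set_system T) {FF : Filter F} (f : T -> R) (l : R)
    (k : nat) : f x @[x --> F] --> l -> f x ^+ k @[x --> F] --> l ^+ k.
Proof.
move=> fl; elim: k => [|k IH]; first exact: cvg_cst.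
rewrite exprS (_ : (fun x => _) = (fun x => f x * f x ^+ k)); first exact: cvgM.
by apply/funext => x; rewrite exprS.
Qed.

Lemma cvg_affine_expr (k : nat) (a b c : R) :
  c * (a + b * d) ^+ k @[d --> 0^'+] --> c * a ^+ k.
Proof.
apply: cvg_at_right_filter.
rewrite -[in X in _ --> X](addr0 a) -[in X in _ --> X](mulr0 b).
apply: cvgM; first exact: cvg_cst.
apply: cvg_expr; apply: cvgD; first exact: cvg_cst.
by apply: cvgM; [exact: cvg_cst|exact: cvg_id].
Qed.

(** To first order in [d] the hypothesis reads [0 <= n a^(n-1) (c - b) d]; the secant bounds for
    powers make this precise without derivatives. *)
Lemma second_difference_slopes (n : nat) (a b c e : R) : (0 < n)%N -> 0 < a ->
  0 <= b -> 0 <= c -> 0 < e ->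
  (forall d, 0 < d < e -> exists p q, [/\ 0 <= p <= a - b * d, 0 <= q <= a + c * d &
     2 * a ^+ n <= p ^+ n + q ^+ n]) ->
  b <= c.
Proof.
move=> n0 a0 b0 c0 e0 H.
have an0 : 0 < a ^+ n.-1 by rewrite exprn_gt0.
rewrite -(ler_pM2r an0).
apply: (ler_cvg_to (@cvg_affine_expr n.-1 a (- b) b) (@cvg_affine_expr n.-1 a c c)).
near=> d.
have d0 : 0 < d by near: d; exact: nbhs_right_gt.
have de : d < e by near: d; exact: nbhs_right_lt.
have [|p [q [/andP[p0 pa] /andP[q0 qa] pq]]] := H d; first by rewrite d0.
have bd0 : 0 <= b * d by rewrite mulr_ge0// ltW.
have cd0 : 0 <= c * d by rewrite mulr_ge0// ltW.
have pn : p ^+ n <= (a - b * d) ^+ n by rewrite lerXn2r ?nnegrE// (le_trans p0).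
have qn : q ^+ n <= (a + c * d) ^+ n by rewrite lerXn2r ?nnegrE// (le_trans q0).
have bda : 0 <= b * d <= a by rewrite bd0 -subr_ge0 (le_trans p0).
have h1 := expr_secant_ge n bda.
have h2 := @expr_secant_le n a (c * d) (ltW a0) cd0.
have h3 : b * d * (n%:R * (a - b * d) ^+ n.-1) <= c * d * (n%:R * (a + c * d) ^+ n.-1) by lra.
have dn0 : 0 < d * n%:R by rewrite mulr_gt0// ltr0n.
rewrite -(ler_pM2l dn0) mulNr.
have -> : d * n%:R * (b * (a - b * d) ^+ n.-1) = b * d * (n%:R * (a - b * d) ^+ n.-1) by ring.
by have -> : d * n%:R * (c * (a + c * d) ^+ n.-1) = c * d * (n%:R * (a + c * d) ^+ n.-1) by ring.
Unshelve. all: by end_near. Qed.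
End slopes.

Section surface_area.
Context {R : realType} {n : nat}.
Implicit Types (x y : 'rV[R]_n) (K L M : set 'rV[R]_n).

Definition radius_slope L (e : R) : R :=
  (mean_radius (outer_parallel L e) - mean_radius L) / e.

Lemma radius_slope_ge0 L e : compact L -> 0 < e -> 0 <= radius_slope L e.
Proof.
move=> cL e0; rewrite divr_ge0 ?(ltW e0)// subr_ge0; apply: le_mean_radius.
apply: le_vol => //; first exact: compact_outer_parallel (ltW e0) cL.
exact: sub_outer_parallel (ltW e0).
Qed.

Lemma vol_outer_parallel_gt0 L e : compact L -> 0 < vol L -> 0 <= e ->
  0 < vol (outer_parallel L e).
Proof.
move=> cL vL e0; apply: lt_le_trans vL _; apply: le_vol => //.
  exact: compact_outer_parallel.
exact: sub_outer_parallel.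
Qed.

(** Brunn-Minkowski for [L] and [L + e B] with weight [s = d / e]. *)
Lemma radius_slope_nonincreasing L (d e : R) : (0 < n)%N -> compact L -> convex_in L ->
  0 < vol L -> 0 < d -> d <= e -> radius_slope L e <= radius_slope L d.
Proof.
move=> n0 cL vL L0 d0; rewrite le_eqVlt => /orP[/eqP->//|de].
have e0 := lt_trans d0 de.
pose s := d / e.
have s01 : 0 < s < 1 by rewrite divr_gt0//= ltr_pdivrMr// mul1r.
have sed : s * e = d by rewrite /s divfK// gt_eqF.
have := @vol_brunn_minkowski R n s L (outer_parallel L e) (outer_parallel L d) n0 s01 cL
  (compact_outer_parallel (ltW e0) cL) (compact_outer_parallel (ltW d0) cL) L0
  (vol_outer_parallel_gt0 cL L0 (ltW e0)).
have H x y : L x -> outer_parallel L e y -> outer_parallel L d ((1 - s) *: x + s *: y).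
  move=> Lx Ly; rewrite -sed; apply: outer_parallel_conv => //; last exact: ltW.
  by case/andP: s01 => s0 s1; rewrite !ltW.
move=> /(_ H); rewrite /radius_slope ler_pdivrMr// => h.
rewrite mulrAC ler_pdivlMr//.
move: h; set a := mean_radius _; set b := mean_radius _; set c := mean_radius _ => h.
have {}h : s * (b - a) <= c - a by lra.
by have := ler_wpM2r (ltW e0) h; rewrite mulrAC sed mulrC.
Qed.

(** [D] is the supremum of the slopes, hence by monotonicity their limit at [0+]; the bound [T]
    keeps it finite. Being the least upper bound, [D] is estimated later through individual
    slopes. *)
Lemma surface_area_slope L (T : R) : (0 < n)%N -> compact L -> convex_in L ->
  0 < vol L -> (forall e, 0 < e -> radius_slope L e <= T) ->
  exists D, [/\ 0 <= D, forall e, 0 < e -> radius_slope L e <= D,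
    forall B, (forall e, 0 < e -> radius_slope L e <= B) -> D <= B &
    surface_area L = n%:R * mean_radius L ^+ n.-1 * D].
Proof.
move=> n0 cL vL L0 LT.
pose I : set R := [set` `]0, +oo[].
have ubI : has_ubound (radius_slope L @` I).
  by exists T => x [e]; rewrite /I/= in_itv/= andbT => e0 <-; exact: LT.
have slope_cvg : radius_slope L e @[e --> 0^'+] --> sup (radius_slope L @` I).
  apply: nonincreasing_at_right_cvgr => //.
  move=> d e; rewrite !in_itv/= !andbT => d0 e0 de.
  exact: radius_slope_nonincreasing.
pose D := sup (radius_slope L @` I).
have slopeD e : 0 < e -> radius_slope L e <= D.
  by move=> e0; apply: sup_ubound => //; exists e => //; rewrite /I/= in_itv/= e0.
exists D; split => //.
- by apply: le_trans (slopeD _ ltr01); apply: radius_slope_ge0.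
- move=> B HB; apply: ge_sup.
    by exists (radius_slope L 1), 1 => //; rewrite /I/= in_itv/= ltr01.
  by move=> _ [e + <-]; rewrite /I/= in_itv/= andbT; exact: HB.
(* Continuity at 0 comes from [f(e) = f(0) + e * slope], as the slopes converge. *)
have radius_cvg : mean_radius (outer_parallel L e) @[e --> 0^'+] --> mean_radius L.
  have : mean_radius L + e * radius_slope L e @[e --> 0^'+] --> mean_radius L + 0 * D.
    apply: cvgD; first exact: cvg_cst.
    apply: cvgM; last exact: slope_cvg.
    by apply: cvg_at_right_filter; exact: cvg_id.
  rewrite mul0r addr0.
  apply: cvg_trans; apply: near_eq_cvg; near=> e.
  have e0 : 0 < e by near: e; exact: nbhs_right_gt.
  by rewrite /radius_slope mulrC divfK ?gt_eqF// addrCA subrr addr0.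
apply: cvg_lim => //.
(* Factoring a difference of n-th powers writes the volume quotient as the slope times [n] products,
   each tending to [f(L)^(n-1)]. *)
have sum_cvg : radius_slope L e * (\sum_(i < n)
    mean_radius (outer_parallel L e) ^+ (n.-1 - i) * mean_radius L ^+ i) @[e --> 0^'+]
    --> D * \sum_(i < n) mean_radius L ^+ (n.-1 - i) * mean_radius L ^+ i.
  apply: cvgM => //.
  apply: (cvg_big (U := R) (op := +%R)) => [|i _]; first exact: add_continuous.
  apply: cvgM; last exact: cvg_cst.
  exact: cvg_expr.
have -> : n%:R * mean_radius L ^+ n.-1 * D =
    D * \sum_(i < n) mean_radius L ^+ (n.-1 - i) * mean_radius L ^+ i.
  rewrite mulrC; congr (_ * _).
  rewrite -[X in X%:R]card_ord -[RHS]mulr1 mulr_natl -sumr_const mulr1.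
  apply: eq_bigr => i _.
  by rewrite -exprD subnK// -ltnS prednK// (leq_ltn_trans _ (ltn_ord i)).
apply: cvg_trans sum_cvg; apply: near_eq_cvg; near=> e.
have e0 : 0 < e by near: e; exact: nbhs_right_gt.
rewrite -/(outer_parallel L e) -(mean_radiusX L)// -(mean_radiusX (outer_parallel L e))//.
by rewrite subrXX /radius_slope mulrAC.
Unshelve. all: by end_near. Qed.

Lemma isoperimetric_quotientE L (D : R) : (0 < n)%N -> 0 < vol L ->
  surface_area L = n%:R * mean_radius L ^+ n.-1 * D ->
  isoperimetric_quotient L = (n%:R * D) ^+ n.
Proof.
move=> n0 L0 sE; rewrite /isoperimetric_quotient sE -(mean_radiusX L n0).
have r0 := mean_radius_gt0 L0.
rewrite mulrAC exprMn -!exprM [(n * _)%N]mulnC mulfK// expf_neq0// gt_eqF//.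
Qed.
End surface_area.

(** * Concavity along the parallel bodies *)

Section inner_parallel_family.
Context {R : realType} {n : nat}.
Implicit Types (x y : 'rV[R]_n) (K L M : set 'rV[R]_n).

Lemma inner_parallel_add K (l m : R) x b : l <= m -> m <= 0 ->
  inner_parallel K l x -> enorm b <= m - l -> inner_parallel K m (x + b).
Proof.
move=> lm m0 /inner_parallelP Kx bml; apply/inner_parallelP => w wm.
rewrite -addrA; apply: Kx; apply: le_trans (enormD _ _) _.
move: wm; rewrite !ler0_norm// ?(le_trans lm)//; lra.
Qed.

(** A vector of length at most [d - l] is the sum of collinear vectors of lengths at most [d] and
    [- l]. *)
Lemma inner_parallel_comp K (l d : R) : l <= 0 -> 0 <= d ->
  inner_parallel (inner_parallel K l) d `<=` inner_parallel K (l - d).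
Proof.
move=> l0 d0 x /inner_parallelP Kx.
have xd b c : enorm b <= d -> enorm c <= - l -> K (x + (b + c)).
  move=> bd cl; have /Kx/inner_parallelP/(_ c) : enorm b <= `|d| by rewrite ger0_norm.
  by rewrite ler0_norm// => /(_ cl); rewrite addrA.
apply/inner_parallelP => b; rewrite ler0_norm; last lra.
rewrite opprB => bdl.
have [e0|en0] := eqVneq (d - l) 0.
  have b0 : b = 0 by apply: enorm_eq0; apply/eqP; rewrite eq_le enorm_ge0 -e0 bdl.
  by have := xd 0 0; rewrite !addr0 b0 enorm0 addr0; apply; lra.
have e0 : 0 < d - l by rewrite lt_neqAle eq_sym en0; lra.
have bd c : 0 <= c -> enorm ((c / (d - l)) *: b) <= c.
  move=> c0; rewrite enormZ ger0_norm ?divr_ge0 ?(ltW e0)// -mulrA ler_piMr//.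
  by rewrite ler_pdivrMl// mulr1.
rewrite (_ : b = (d / (d - l)) *: b + (- l / (d - l)) *: b).
  by apply: xd; apply: bd => //; rewrite oppr_ge0.
by rewrite -scalerDl -mulrDl mulfV// scale1r.
Qed.

(** The strict inequality leaves a margin [r + l]: half of it pays for the shift [e], the other half
    for a ball inside the inner body. This gives room for difference quotients to the left of
    [l]. *)
Lemma inner_parallel_vol_gt0 K (l : R) : compact K -> K !=set0 ->
  - inradius K < l -> l <= 0 ->
  exists2 d, 0 < d & forall e, 0 <= e <= d -> 0 < vol (inner_parallel K (l - e)).
Proof.
move=> cK [x0 Kx0]; rewrite ltrNl => lr l0.
(* The set of admissible radii is nonempty thanks to the degenerate ball at [x0], so some admissible
   [r] exceeds [- l]. *)
have [|r [r0 [x xrK]] lr'] := sup_gt _ lr.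
  exists 0; split=> //; exists x0 => _ [_ [b _ <-] <-].
  by rewrite scale0r addr0.
exists ((r + l) / 2); first by rewrite divr_gt0//; lra.
move=> e /andP[e0 er].
apply: (@vol_gt0 R n _ x ((r + l) / 2)); first by rewrite divr_gt0//; lra.
  exact: compact_inner_parallel.
move=> b br; apply/inner_parallelP => w; rewrite ler0_norm; last lra.
move=> we; rewrite -addrA; apply: xrK; exists (b + w) => //.
rewrite dilate_unit_ball//=; apply: le_trans (enormD _ _) _; lra.
Qed.

Lemma mean_radius_inner_concave K (a b c : R) : (0 < n)%N -> compact K -> convex_in K ->
  a < b -> b < c -> c <= 0 ->
  0 < vol (inner_parallel K a) -> 0 < vol (inner_parallel K c) ->
  (mean_radius (inner_parallel K c) - mean_radius (inner_parallel K b)) / (c - b) <=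
  (mean_radius (inner_parallel K b) - mean_radius (inner_parallel K a)) / (b - a).
Proof.
move=> n0 cK vK ab bc c0 va vc.
have ca0 : 0 < c - a by lra.
have ba0 : 0 < b - a by lra.
have cb0 : 0 < c - b by lra.
pose s := (b - a) / (c - a).
have s0 : 0 < s by rewrite divr_gt0.
have s1 : s < 1 by rewrite ltr_pdivrMr// mul1r; lra.
have sE : (1 - s) * a + s * c = b by rewrite /s; field; rewrite gt_eqF.
have := @vol_brunn_minkowski R n s (inner_parallel K a) (inner_parallel K c)
  (inner_parallel K b) n0.
rewrite s0 s1 => /(_ isT (compact_inner_parallel cK) (compact_inner_parallel cK)
  (compact_inner_parallel cK) va vc) H.
have {}H := H _.
have conv x y : inner_parallel K a x -> inner_parallel K c y ->
    inner_parallel K b ((1 - s) *: x + s *: y).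
  move=> Kx Ky; rewrite -sE; apply: inner_parallel_conv => //; first by rewrite !ltW.
  by lra.
have {H conv} := H conv.
set fa := mean_radius _; set fb := mean_radius (inner_parallel K b); set fc := mean_radius _ => H.
rewrite ler_pdivrMr// mulrAC ler_pdivlMr//.
have := ler_wpM2r (ltW ca0) H.
rewrite mulrDl -!mulrA ![_ * (c - a)]mulrC !mulrA.
have -> : (1 - s) * (c - a) = c - b by rewrite /s; field; rewrite gt_eqF.
have -> : s * (c - a) = b - a by rewrite /s divfK// gt_eqF.
lra.
Qed.

(** Concavity at the junction: slopes to the right of [m] are at most the slope to its left. It also
    supplies the bound [T] that makes the supremum of the slopes finite. *)
Lemma radius_slope_le_inner K (l m e : R) : (0 < n)%N -> compact K -> convex_in K ->
  l < m -> m <= 0 -> 0 < vol (inner_parallel K l) -> 0 < vol (inner_parallel K m) -> 0 < e ->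
  radius_slope (inner_parallel K m) e <=
  (mean_radius (inner_parallel K m) - mean_radius (inner_parallel K l)) / (m - l).
Proof.
move=> n0 cK vK lm m0 vl vm e0.
have t0 : 0 < m - l by lra.
set t := m - l in t0 *.
have te0 : 0 < t + e by lra.
have cM := compact_inner_parallel (l := m) cK.
have := @vol_brunn_minkowski R n (t / (t + e)) (inner_parallel K l)
  (outer_parallel (inner_parallel K m) e) (inner_parallel K m) n0.
have s01 : 0 < t / (t + e) < 1 by rewrite divr_gt0//= ltr_pdivrMr// mul1r; lra.
move=> /(_ s01 (compact_inner_parallel cK) (compact_outer_parallel (ltW e0) cM) cM vl
  (vol_outer_parallel_gt0 cM vm (ltW e0))) H.
have conv x y : inner_parallel K l x -> outer_parallel (inner_parallel K m) e y ->
    inner_parallel K m ((1 - t / (t + e)) *: x + (t / (t + e)) *: y).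
  apply: inner_outer_conv => //; first exact: convex_in_inner_parallel.
  by move=> z b Kz bt; apply: inner_parallel_add Kz bt => //; exact: ltW.
have := ler_wpM2r (ltW te0) (H conv).
rewrite /radius_slope.
set fa := mean_radius _; set fb := mean_radius (outer_parallel _ _); set fc := mean_radius _.
rewrite mulrDl -!mulrA ![_ * (t + e)]mulrC !mulrA.
have -> : (1 - t / (t + e)) * (t + e) = e by field; rewrite gt_eqF.
rewrite divfK ?gt_eqF// => h.
rewrite ler_pdivrMr// mulrAC ler_pdivlMr//.
lra.
Qed.
End inner_parallel_family.

Theorem theorem4p1 (R : realType) (n : nat) (K : set 'rV[R]_n)
    (hn : (0 < n)%N) (hK : convex_body K) (hK0 : interior K !=set0)
    (hU : forall l : R, - inradius K < l <= 0 ->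
       extreme_normals (form_body (inner_parallel K l)) =
       extreme_normals (minkowski_sum (inner_parallel K l)
                          (form_body (inner_parallel K l)))) :
  forall l m : R, - inradius K < l -> l <= m -> m <= 0 ->
    isoperimetric_quotient (inner_parallel K m) <=
    isoperimetric_quotient (inner_parallel K l).
Proof.
move=> l m lr; rewrite le_eqVlt => /orP[/eqP->//|lm] m0.
have vK := convex_body_convex_in hK; case: hK => K0 cK _.
have l0 : l <= 0 by lra.
have [d0 d0_gt0 vol_l] := inner_parallel_vol_gt0 cK K0 lr l0.
pose L := inner_parallel K l; pose M := inner_parallel K m.
have cL : compact L := compact_inner_parallel cK.
have cM : compact M := compact_inner_parallel cK.
have xL : convex_in L := convex_in_inner_parallel vK.
have xM : convex_in M := convex_in_inner_parallel vK.
have vL : 0 < vol L.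
  by have := vol_l 0; rewrite subr0 lexx (ltW d0_gt0); exact.
have LM : L `<=` M.
  move=> x Lx; rewrite -(addr0 x); apply: inner_parallel_add Lx _ => //; first exact: ltW.
  by rewrite enorm0; lra.
have vM : 0 < vol M by apply: lt_le_trans vL (le_vol cL cM LM).
have L0 : L !=set0.
  apply/set0P; apply: contraTN vL => /eqP ->.
  by rewrite /vol (_ : [set t | _] = set0) ?measure0//= ltxx.
have vl (d : R) : 0 < d <= d0 -> 0 < vol (inner_parallel K (l - d)).
  by move=> /andP[/ltW d00 dd0]; apply: vol_l; rewrite d00.
have slopeM e : 0 < e -> radius_slope M e <= (mean_radius M - mean_radius L) / (m - l).
  exact: radius_slope_le_inner.
have slopeL e : 0 < e -> radius_slope L e <=
    (mean_radius L - mean_radius (inner_parallel K (l - d0))) / (l - (l - d0)).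
  by apply: radius_slope_le_inner => //; [lra|apply: vl; rewrite d0_gt0 lexx].
have [DM [DM0 _ DM_least sM]] := surface_area_slope hn cM xM vM slopeM.
have [DL [DL0 DL_ub _ sL]] := surface_area_slope hn cL xL vL slopeL.
rewrite (isoperimetric_quotientE hn vM sM) (isoperimetric_quotientE hn vL sL).
rewrite lerXn2r ?nnegrE ?mulr_ge0// ler_wpM2l//.
(* It suffices to bound a single slope [s] of [M], so [e] stays fixed while [d] tends to 0. *)
apply: DM_least => e e0.
set s := radius_slope M e.
rewrite leNgt; apply/negP => DLs.
have s0 : 0 < s by apply: le_lt_trans DLs.
(* The midpoint of 1 and [2 DL / (s + DL)], a ratio below 1 since [DL < s]. Thus
   [c (s + DL) > 2 DL], which contradicts [s c <= DL (2 - c)]. *)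
pose c := (2 * DL / (s + DL) + 1) / 2.
have sD0 : 0 < s + DL by lra.
have q01 : 0 <= 2 * DL / (s + DL) < 1.
  by rewrite divr_ge0 ?mulr_ge0 ?(ltW sD0)//= ltr_pdivrMr// mul1r; lra.
have c01 : 0 < c < 1 by rewrite /c; lra.
have /andP[c0 c1] := c01.
have : s * c <= DL * (2 - c).
  apply: (second_difference_slopes (n := n) (a := mean_radius L) (e := d0)) => //.
  - exact: mean_radius_gt0.
  - by rewrite mulr_ge0// ltW.
  - by rewrite mulr_ge0//; lra.
  move=> d /andP[d_gt0 dd0].
  have cd0 : 0 < c * d by rewrite mulr_gt0.
  have cdd : c * d <= d by rewrite ler_piMl// ltW.
  have cd2 : 0 < (2 - c) * d by rewrite mulr_gt0//; lra.
  exists (mean_radius (inner_parallel L (c * d))), (mean_radius (outer_parallel L ((2 - c) * d))).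
  rewrite !mean_radius_ge0 !mean_radiusX//; split => /=.
  (* The inner body of [L] lies in [K_(l - cd)]. By concavity [s] is at most the slope on [[l, m]],
     hence at most the one on [[l - cd, l]]. *)
  - apply: (@le_trans _ _ (mean_radius (inner_parallel K (l - c * d)))).
      apply/le_mean_radius/le_vol; try exact: compact_inner_parallel.
      by apply: inner_parallel_comp => //; exact: ltW.
    have v_cd : 0 < vol (inner_parallel K (l - c * d)) by apply: vl; lra.
    have h1 := slopeM e e0.
    have h2 : (mean_radius M - mean_radius L) / (m - l) <=
        (mean_radius L - mean_radius (inner_parallel K (l - c * d))) / (l - (l - c * d)).
      by apply: mean_radius_inner_concave => //; lra.
    have := le_trans h1 h2; rewrite -/s opprB addrCA subrr addr0 ler_pdivlMr// mulrA; lra.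
  - have := DL_ub _ cd2; rewrite /radius_slope ler_pdivrMr// mulrA; lra.
  - by apply: vol_shell.
have : 2 * DL < c * (s + DL).
  by rewrite -ltr_pdivrMr// /c; lra.
lra.
Qed.
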